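(* Let $n\in\mathbb N$ and $\lambda\vdash n$. Then $$C(\lambda)=\left(\sum_{i\ge1}\binom{\lambda_i}{2}+\sum_{i\ge1}\binom{\lambda'_i}{2}\right)(H_n-1)-\sum_{x\in\lambda}\sum_{k=1}^{n-1}h'(x)\frac{f_\lambda(k,x)}{f_\lambda}H_{n-k}=\sum_{x\in\lambda}\sum_{k=1}^{n-1}h'(x)\frac{f_\lambda(k,x)}{f_\lambda}\,(H_n-H_{n-k}-1).$$
   Context: A partition $\lambda\vdash n$ is identified with its Young diagram $\{(i,j): i\ge1,\ 1\le j\le\lambda_i\}$; $\lambda'$ is the conjugate partition. For $x=(i,j)$, $h'(x)=i+j-2$. $H_m=\sum_{k=1}^m 1/k$ is the $m$-th harmonic number. A tabloid is a bijection $T:\lambda\to\{1,\dots,n\}$; $\operatorname{T}(\lambda)$ is the set of tabloids. A standard Young tableau is a tabloid with entries increasing along rows and down columns; $f_\lambda$ is their number and $f_\lambda(k,x)$ the number with entry $k$ in cell $x$. Order cells by $(i,j)\prec(k,l)$ iff $j<l$, or $j=l$ and $i<k$; list them $z_1\prec\dots\prec z_n$. Novelli--Pak--Stoyanovskii sorting of $T$: $T_{z_n}:=T$; for $m=n-1,\dots,1$, $T_{z_m}$ is obtained from $T_{z_{m+1}}$ by the slide at $z_m$, which repeatedly exchanges the entry in $z_m$ with the smaller of the entries in its current right and bottom neighbours as long as that entry is smaller than it. Let $r(T)$ be the total number of such exchanges performed over all slides in sorting $T$. The complexity is $C(\lambda):=\frac1{n!}\sum_{T\in\operatorname{T}(\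lambda)}r(T)$.
   Formalization: In the last expression the inner sum is taken over k=1,…,n instead of k=1,…,n−1; as printed the second equality fails, e.g. for λ=(2,1), where C(λ)=2/3 but the last sum up to n−1 equals −1/6. *)

(* Defs.v *)
From mathcomp Require Import all_boot all_order all_algebra.
Set Implicit Arguments. Unset Strict Implicit. Unset Printing Implicit Defensive.
Import GRing.Theory Num.Theory.
Local Open Scope ring_scope.

(* Partitions are nonincreasing sequences of positive naturals.
   Cells are 0-indexed pairs (i, j) = (row, column); the paper's cell (i, j)
   (1-indexed) is our (i-1, j-1). *)
Definition is_partition (n : nat) (la : seq nat) : bool :=
  [&& sorted geq la, all (fun x => 0 < x)%N la & sumn la == n].

Definition conj_part (la : seq nat) : seq nat :=
  [seq count (fun x => j < x)%N la | j <- iota 0 (head 0%N la)].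

Definition in_diag (la : seq nat) (c : nat * nat) : bool :=
  (c.2 < nth 0%N la c.1)%N.

(* cells listed in the order z_1 < ... < z_n : by column, then by row *)
Definition cells (la : seq nat) : seq (nat * nat) :=
  flatten [seq [seq (i, j) | i <- iota 0 (size la) & (j < nth 0%N la i)%N]
          | j <- iota 0 (head 0%N la)].

(* h'(x) = i + j - 2 in 1-indexed coordinates = i + j in 0-indexed ones *)
Definition hprime (c : nat * nat) : nat := (c.1 + c.2)%N.

Definition harmonic (m : nat) : rat := \sum_(1 <= k < m.+1) (k%:R)^-1.

Definition filling := nat * nat -> nat.

(* A tabloid of shape la (a bijection la -> {1..n}) is encoded by the
   sequence s of its values along z_1, ..., z_n; tabloids correspond
   bijectively to the permutations of [:: 1; ...; n]. *)
Definition tabloids (n : nat) : seq (seq nat) := permutations (iota 1 n).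

Definition fill_of (la : seq nat) (s : seq nat) : filling :=
  fun c => nth 0%N s (index c (cells la)).

Definition is_standard (la : seq nat) (F : filling) : bool :=
  all (fun c =>
         (in_diag la (c.1, c.2.+1) ==> (F c < F (c.1, c.2.+1))%N) &&
         (in_diag la (c.1.+1, c.2) ==> (F c < F (c.1.+1, c.2))%N))
      (cells la).

Definition fsyt (n : nat) (la : seq nat) : nat :=
  count (fun s => is_standard la (fill_of la s)) (tabloids n).

Definition fsyt_at (n : nat) (la : seq nat) (k : nat) (x : nat * nat) : nat :=
  count (fun s => is_standard la (fill_of la s) && (fill_of la s x == k))
        (tabloids n).

Definition swapf (F : filling) (p q : nat * nat) : filling :=
  fun d => if d == p then F q else if d == q then F p else F d.

Definition slide_target (la : seq nat) (F : filling) (p : nat * nat)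
  : option (nat * nat) :=
  let r := (p.1, p.2.+1) in
  let b := (p.1.+1, p.2) in
  let cand :=
    match in_diag la r, in_diag la b with
    | true, true => Some (if (F b < F r)%N then b else r)
    | true, false => Some r
    | false, true => Some b
    | false, false => None
    end in
  match cand with
  | Some q => if (F q < F p)%N then Some q else None
  | None => None
  end.

(* slide starting at p; returns the new filling and the number of exchanges.
   fuel bounds the number of steps (each exchange moves to a new cell, so
   fuel = n suffices). *)
Fixpoint slide (fuel : nat) (la : seq nat) (F : filling) (p : nat * nat)
  : filling * nat :=
  match fuel with
  | 0 => (F, 0%N)
  | f.+1 =>
    match slide_target la F p with
    | None => (F, 0%N)
    | Some q => let: (G, k) := slide f la (swapf F p q) q in (G, k.+1)
    end
  end.

Definition nps_exchanges (la : seq nat) (F : filling) : nat :=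
  let z := cells la in
  (foldl (fun (st : filling * nat) c =>
            let: (G, k) := slide (size z) la st.1 c in (G, (st.2 + k)%N))
         (F, 0%N) (rev (take (size z).-1 z))).2.

Definition complexity (n : nat) (la : seq nat) : rat :=
  (\sum_(s <- tabloids n) (nps_exchanges la (fill_of la s))%:R) / (n`!)%:R.

(* Main.v *)
Require Import Defs.
From mathcomp Require Import all_boot all_order all_algebra.
From mathcomp Require Import zify ring.
From Stdlib Require Import FunctionalExtensionality.
Import GRing.Theory Num.Theory.

(** Every exchange moves a large entry one step away from the corner and a
    smaller one a step back, so for each [t] the sum of [h'(x)] over the cells
    with entries at least [t] grows by the number of exchanges of some [a < t]
    with some [b >= t]. While an entry [b] slides, the exchanged entries smaller
    than [t <= b] are those on the slide path of the sorted cells, which is the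
    same for all such [b]. Hence the expected growth, divided by [n - t + 1],
    counts the exchanges made by the entry [t], and the sum over [t] is the
    complexity. The growth depends only on the first and the last filling; the
    first is uniform, and the last is uniform on standard tableaux.

    For the latter we use the bijection of Novelli, Pak and Stoyanovskii, one
    column at a time: a slide is recorded by the content of the cell where it
    ends, and it can be undone because, among the cells designated by the
    recorded contents, that one has the reverse slide path furthest to the top
    right. *)

(** The obstacle is that halfway through a column the sorted filling is not uniform, because the
    sorted cells then form a skew shape. In the two by two square, once the bottom left cell has
    been sorted, its entry exceeds the one in the upper right corner with probability 2/3. The
    induction over the cells therefore carries a weighted law: a filling occurs in proportion to the
    number of hook lists all of whose designated cells have reverse paths that leave row [i] in
    column [j]. For [i = 0] there is no row to escape to, the condition is void and the weight is a
    constant of the shape; so uniformity reappears at the end of each column.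

    The two parts of the factor [H_n - H_{n-k} - 1] have separate origins. An entry [k] of the final
    tableau counts in the potentials with [t <= k], and the weights [1/(n-t+1)] of these add up to
    [H_n - H_{n-k}]. In the initial filling a cell holds an entry at least [t] with probability
    [(n-t+1)/n]; the weight cancels the numerator, and the [n] values of [t] together give the
    [-1]. *)

Set Implicit Arguments.
Unset Strict Implicit.
Unset Printing Implicit Defensive.
Local Open Scope nat_scope.

(** * The cells of a Young diagram, listed column by column *)

Section Diagram.
Variables (n : nat) (la : seq nat).
Hypothesis hla : is_partition n la.

Definition col_height (j : nat) : nat := count (fun x => j < x) la.

Lemma row_le (a b : nat) : a <= b -> nth 0 la b <= nth 0 la a.
Proof.
move=> ab; have /and3P[sla _ _] := hla.
have [bs|bs] := ltnP b (size la); last by rewrite (nth_default _ bs).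
apply: (@sorted_leq_nth _ geq _ _ 0 la sla a b) => //.
- by move=> x y z; rewrite /geq /= => h1 h2; apply: leq_trans h2 h1.
- by move=> x; rewrite /geq /=.
- by rewrite inE (leq_ltn_trans ab bs).
Qed.

Lemma ltn_col_height (a j : nat) : (a < col_height j) = (j < nth 0 la a).
Proof.
have /and3P[sla _ _] := hla.
rewrite /col_height; elim: la sla a => [|x s IH] /= ps a; first by rewrite nth_nil.
have ss : sorted geq s by apply: path_sorted ps.
have xs : all (geq x) s.
  by apply: order_path_min ps => u v w; rewrite /geq /= => h1 h2; apply: leq_trans h2 h1.
case: a => [|a] /=.
  case: (ltnP j x) => jx //=.
  rewrite add0n -has_count; apply/negbTE/hasPn => y ys.
  by rewrite -leqNgt; apply: leq_trans jx; have /allP/(_ y ys) := xs.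
rewrite -IH //; case: (ltnP j x) => jx; first by rewrite add1n ltnS.
have -> : count [eta leq j.+1] s = 0.
  apply/eqP; rewrite -leqn0 leqNgt -has_count; apply/hasPn => y ys.
  by rewrite -leqNgt; apply: leq_trans jx; have /allP/(_ y ys) := xs.
by [].
Qed.

Lemma col_height_size (j : nat) : col_height j <= size la.
Proof. exact: count_size. Qed.

Lemma col_height_gt0 (j : nat) : (0 < col_height j) = (j < head 0 la).
Proof. by rewrite ltn_col_height nth0. Qed.

Lemma in_diag_le (x y : nat * nat) :
  x.1 <= y.1 -> x.2 <= y.2 -> in_diag la y -> in_diag la x.
Proof.
by rewrite /in_diag => h1 h2 h3; apply: leq_ltn_trans h2 (leq_trans h3 (row_le h1)).
Qed.

Definition colcells (j : nat) : seq (nat * nat) := [seq (i, j) | i <- iota 0 (col_height j)].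

Lemma cellsE : cells la = flatten [seq colcells j | j <- iota 0 (head 0 la)].
Proof.
rewrite /cells; congr flatten; apply: eq_map => j; rewrite /colcells; congr map.
rewrite -(filter_iota_ltn 0 (col_height_size j)); apply: eq_filter => i.
by rewrite add0n ltn_col_height.
Qed.

Lemma mem_cells (x : nat * nat) : (x \in cells la) = in_diag la x.
Proof.
rewrite cellsE; apply/flatten_mapP/idP => [[j _ /mapP[i]]|].
  by rewrite mem_iota => /andP[_ h] ->; rewrite /in_diag /= -ltn_col_height.
rewrite /in_diag -ltn_col_height => h; exists x.2.
  by rewrite mem_iota add0n /= -col_height_gt0 (leq_ltn_trans _ h).
by apply/mapP; exists x.1; [rewrite mem_iota|case: x {h}].
Qed.

Definition cells_from (i j : nat) : seq (nat * nat) :=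
  [seq (a, j) | a <- iota i (col_height j - i)] ++
  flatten [seq colcells j' | j' <- iota j.+1 (head 0 la - j.+1)].

Lemma cells_from00 : cells la = cells_from 0 0.
Proof.
rewrite cellsE /cells_from subn0.
have [e|h] := posnP (head 0 la).
  by rewrite e /=; have := col_height_gt0 0; rewrite e; case: (col_height 0).
by rewrite -{1}(prednK h) /= subn1.
Qed.

Lemma cells_from_cons (i j : nat) : i < col_height j ->
  cells_from i j = (i, j) :: cells_from i.+1 j.
Proof. by move=> h; rewrite /cells_from -(subnSK h). Qed.

Lemma cells_from_col (j : nat) : cells_from (col_height j) j = cells_from 0 j.+1.
Proof.
rewrite /cells_from subnn /= subn0.
have [h|h] := ltnP j.+1 (head 0 la); first by rewrite -(subnSK h).
have -> : head 0 la - j.+1 = 0 by lia.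
have -> : head 0 la - j.+2 = 0 by lia.
by have := col_height_gt0 j.+1; rewrite [j.+1 < _]ltnNge h /=; case: col_height.
Qed.

Lemma cells_from_end : cells_from 0 (head 0 la) = [::].
Proof.
rewrite /cells_from subn0; have -> : head 0 la - (head 0 la).+1 = 0 by lia.
have := col_height_gt0 (head 0 la); rewrite ltnn; by case: col_height.
Qed.

Definition region (i j : nat) (x : nat * nat) : bool :=
  in_diag la x && ((j < x.2) || (x.2 == j) && (i <= x.1)).

Lemma mem_cells_from (i j : nat) (x : nat * nat) : (x \in cells_from i j) = region i j x.
Proof.
rewrite mem_cat /region; case: x => a b /=; rewrite /in_diag /= -ltn_col_height.
have -> : ((a, b) \in [seq (a0, j) | a0 <- iota i (col_height j - i)]) =
    (b == j) && (i <= a < col_height j).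
  apply/mapP/andP => [[c]|[/eqP -> h]].
    by rewrite mem_iota => h [-> ->]; split => //; lia.
  by exists a => //; rewrite mem_iota; lia.
have -> : ((a, b) \in flatten [seq colcells j' | j' <- iota j.+1 (head 0 la - j.+1)]) =
    (j < b) && (a < col_height b).
  apply/flatten_mapP/andP => [[c]|[h1 h2]].
    rewrite mem_iota => h /mapP[d]; rewrite mem_iota => h' [-> ->]; lia.
  exists b; last by apply/mapP; exists a; rewrite // mem_iota.
  have : 0 < col_height b by lia.
  rewrite col_height_gt0 mem_iota; lia.
case: eqP => [->|_]; first by rewrite ltnn /= orbF andbC.
by rewrite /= orbF andbC.
Qed.

Lemma uniq_cells_from_step (i j : nat) : (i, j) \notin cells_from i.+1 j.
Proof. by rewrite mem_cells_from /region /= eqxx !ltnn /= andbF. Qed.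

(** Backward induction along the sorting order. The second premise only renames an unchanged list of
    cells, from [(0, j+1)] to [(col_height la j, j)]; it is kept apart because the hook lists start
    afresh there. *)
Lemma cells_from_ind (P : nat -> nat -> Prop) :
  P 0 (head 0 la) ->
  (forall j, j < head 0 la -> P 0 j.+1 -> P (col_height j) j) ->
  (forall i j, i < col_height j -> P i.+1 j -> P i j) -> P 0 0.
Proof.
move=> h0 hc hs.
have row i j : j < head 0 la -> P (col_height j) j -> i <= col_height j -> P (col_height j - i) j.
  move=> hj hP; elim: i => [|i IH] hi; first by rewrite subn0.
  by apply: hs; [lia|rewrite subnSK //; apply: IH; lia].
have col k : k <= head 0 la -> P 0 (head 0 la - k).
  elim: k => [|k IH] hk; first by rewrite subn0.
  have := @row (col_height (head 0 la - k.+1)) (head 0 la - k.+1).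
  rewrite subnn; apply; first by lia.
    by apply: hc; [lia|rewrite subnSK //; apply: IH; lia].
  exact: leqnn.
by have := col _ (leqnn _); rewrite subnn.
Qed.

Lemma uniq_cells : uniq (cells la).
Proof.
rewrite cells_from00; apply: (@cells_from_ind (fun i j => uniq (cells_from i j))).
- by rewrite cells_from_end.
- by move=> j _; rewrite cells_from_col.
- by move=> i j h; rewrite (cells_from_cons h) /= => ->; rewrite uniq_cells_from_step.
Qed.

Lemma sum_cells_col (f : nat * nat -> nat) :
  \sum_(x <- cells la) f x = \sum_(0 <= j < head 0 la) \sum_(0 <= i < col_height j) f (i, j).
Proof.
rewrite cellsE big_flatten big_map /index_iota subn0; apply: eq_bigr => j _.
by rewrite big_map subn0.
Qed.

Lemma mem_le_head x : x \in la -> x <= head 0 la.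
Proof.
move=> /(nthP 0)[i _ <-]; rewrite -nth0; exact: row_le.
Qed.

Lemma sum_cells_snd (f : nat -> nat) :
  \sum_(x <- cells la) f x.2 = \sum_(a <- la) \sum_(0 <= j < a) f j.
Proof.
rewrite sum_cells_col.
under eq_bigr do rewrite /= sum_nat_const_nat subn0 /col_height -sum1_count big_distrl /=.
under eq_bigr do rewrite big_mkcond.
rewrite exchange_big /= big_seq [RHS]big_seq; apply: eq_bigr => a /mem_le_head ha.
rewrite (big_cat_nat_idem _ _ (n := a)) //= big_nat (eq_bigr f) -?big_nat.
  rewrite [X in _ + X]big_nat_cond [X in _ + X]big1 ?addn0 // => i /andP[/andP[h1 _] _].
  by rewrite ltnNge h1.
by move=> i /andP[_ ->]; rewrite mul1n.
Qed.

Lemma size_cells : size (cells la) = n.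
Proof.
have /and3P[_ _ /eqP <-] := hla.
rewrite -sum1_size (sum_cells_snd (fun=> 1)) sumnE; apply: eq_bigr => a _.
by rewrite sum_nat_const_nat subn0 muln1.
Qed.

(** The column indices in a row of length [a] add up to ['C(a, 2)], and so do the row indices in a
    column of length [a]. *)
Lemma sum_hprime : \sum_(x <- cells la) hprime x =
  \sum_(a <- la) 'C(a, 2) + \sum_(a <- conj_part la) 'C(a, 2).
Proof.
rewrite /hprime big_split /= addnC; congr addn.
  by rewrite (sum_cells_snd id); apply: eq_bigr => a _; rewrite bin2_sum.
rewrite sum_cells_col /conj_part big_map /index_iota subn0; apply: eq_bigr => j _ /=.
by rewrite -/(col_height j) -bin2_sum /index_iota subn0.
Qed.

(** The cells from the corner down to the row of [x] and then right to [x] lie in the diagram, and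
    there are [hprime x + 1] of them. As every exchange raises [hprime] by one, [n] is enough fuel
    for a slide. *)
Lemma hprime_lt (x : nat * nat) : in_diag la x -> hprime x < n.
Proof.
rewrite -mem_cells => hx.
have sub : {subset [seq (a, 0) | a <- iota 0 x.1] ++ [seq (x.1, b) | b <- iota 0 x.2.+1]
    <= cells la}.
  move: hx; rewrite mem_cells => hx y; rewrite mem_cat => /orP[] /mapP[a].
    rewrite mem_iota => h ->; rewrite mem_cells; apply: in_diag_le hx => //=; lia.
  rewrite mem_iota => h ->; rewrite mem_cells; apply: in_diag_le hx => //=; lia.
have := uniq_leq_size _ sub; rewrite size_cells size_cat !size_map !size_iota /hprime addnS.
apply; rewrite cat_uniq !map_inj_uniq ?iota_uniq; [|by move=> ? ? []..].
rewrite andbT andTb; apply/hasPn => y /mapP[b _ ->]; apply/mapP => [[a]].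
rewrite mem_iota => h [] ? _; lia.
Qed.

End Diagram.

(** * Exit columns of reverse slide paths *)

Section ReversePaths.
Variable j : nat.

(** A reverse slide path moves to the larger of the left and upper neighbours,
    the columns to the left of [j] being absent: [upcol F a b] is the column in
    which the path through [(a, b)] leaves row [a], and [exitcol F h b k] the
    column in which the path from [(h, b)] enters row [h - k]. *)
Fixpoint upcol (F : filling) (a b : nat) : nat :=
  if b is b'.+1 then
    if (b <= j) || (F (a, b') < F (a.-1, b)) then b else upcol F a b'
  else 0.

Fixpoint exitcol (F : filling) (h b k : nat) : nat :=
  if k is k'.+1 then exitcol F h.-1 (upcol F h b) k' else b.

Lemma upcol_le F a b : upcol F a b <= b.
Proof. by elim: b => //= b IH; case: ifP => // _; apply: leqW. Qed.

Lemma upcol_ge F a b : j <= b -> j <= upcol F a b.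
Proof.
elim: b => //= b IH; case: ifP => // /negbT; rewrite negb_or -ltnNge => /andP[h _] _.
by apply: IH.
Qed.

(** The path has to turn left in every column beyond [c], which is one inequality per column. In
    this form the effect of an exchange is confined to the few inequalities that involve the two
    exchanged cells. *)
Lemma upcol_leP F a b c : j <= c ->
  upcol F a b <= c <-> (forall x, c < x -> x <= b -> F (a.-1, x) <= F (a, x.-1)).
Proof.
move=> jc; elim: b => [|b IH] /=; first by split=> // _ x h1 h2; lia.
case: ifP => [/orP h|/negbT].
  split=> [h1 x h2 h3|H]; first by lia.
  rewrite leqNgt; apply/negP => cb; have /= := H b.+1 cb (leqnn _).
  by rewrite leqNgt; case: h => [h|->//]; lia.
rewrite negb_or -!leqNgt => /andP[h1 h2]; split=> [h x h3|h].
  move=> h4; have [xb|->//] : x <= b \/ x = b.+1 by lia.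
  by apply: (IH.1 h).
by apply: IH.2 => x h3 h4; apply: h => //; apply: leqW.
Qed.

(** A path from further right either leaves the row before reaching column [b] or merges with the
    path that starts there. This is why reverse paths do not cross. *)
Lemma upcol_mono F a b b' : b <= b' -> upcol F a b <= upcol F a b'.
Proof.
elim: b' => [|c IH]; first by rewrite leqn0 => /eqP ->.
rewrite leq_eqVlt => /orP[/eqP -> //|]; rewrite ltnS => h.
rewrite [X in _ <= X]/=; case: ifP => _; last exact: IH.
by apply: leq_trans (upcol_le _ _ _) _; apply: leqW.
Qed.

Lemma upcol_ext F G a b :
  (forall x, j < x -> x <= b -> F (a, x.-1) = G (a, x.-1) /\ F (a.-1, x) = G (a.-1, x)) ->
  upcol F a b = upcol G a b.
Proof.
elim: b => //= b IH H; rewrite IH; last by move=> x h1 h2; apply: H => //; apply: leqW.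
have [//|h] /= := leqP b.+1 j; by have /= [-> ->] := H b.+1 h (leqnn _).
Qed.

Lemma exitcol_le F h b k : exitcol F h b k <= b.
Proof.
by elim: k h b => //= k IH h b; apply: leq_trans (IH _ _) (upcol_le _ _ _).
Qed.

Lemma exitcol_ge F h b k : j <= b -> j <= exitcol F h b k.
Proof. by elim: k h b => //= k IH h b jb; apply: IH; apply: upcol_ge. Qed.

Lemma exitcol_mono F h b b' k : b <= b' -> exitcol F h b k <= exitcol F h b' k.
Proof. by elim: k h b b' => //= k IH h b b' bb; apply: IH; apply: upcol_mono. Qed.

Lemma exitcolD F h b k1 k2 :
  exitcol F h b (k1 + k2) = exitcol F (h - k1) (exitcol F h b k1) k2.
Proof.
elim: k1 h b => [|k IH] h b /=; first by rewrite subn0.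
by rewrite IH; congr exitcol; lia.
Qed.

Lemma exitcolS F h b k : exitcol F h b k.+1 = upcol F (h - k) (exitcol F h b k).
Proof. by rewrite -addn1 exitcolD. Qed.

Lemma exitcol_ext F G h b k : k <= h ->
  (forall a x, h - k < a <= h -> j < x -> x <= b ->
    F (a, x.-1) = G (a, x.-1) /\ F (a.-1, x) = G (a.-1, x)) ->
  exitcol F h b k = exitcol G h b k.
Proof.
elim: k h b => //= k IH h b kh H.
rewrite (@upcol_ext F G); last by move=> x; apply: H; lia.
apply: IH => [|a x h1 h2 h3]; first by lia.
by apply: H => //; [lia|apply: leq_trans h3 (upcol_le _ _ _)].
Qed.

End ReversePaths.

(** * The cell order, exchanges of two cells, and the choice made by a slide step *)

Definition cell_le (x y : nat * nat) : bool := (x.1 <= y.1) && (x.2 <= y.2).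

Lemma cell_le_anti x y : cell_le x y -> cell_le y x -> x = y.
Proof.
case: x y => [x1 x2] [y1 y2]; rewrite /cell_le /= => /andP[h1 h2] /andP[h3 h4].
by congr pair; lia.
Qed.

Lemma cell_le_trans y x z : cell_le x y -> cell_le y z -> cell_le x z.
Proof.
by move=> /andP[h1 h2] /andP[h3 h4]; apply/andP; split; [apply: leq_trans h3|apply: leq_trans h4].
Qed.

Lemma swapfC F p q : swapf F p q = swapf F q p.
Proof.
apply: functional_extensionality => x; rewrite /swapf.
by case: (x =P p) => [->|_]; case: eqP => // ->.
Qed.

Lemma swapfK F p q : swapf (swapf F p q) q p = F.
Proof.
apply: functional_extensionality => x; rewrite /swapf.
case: (x =P q) => [->|_]; first by rewrite eqxx.
case: (x =P p) => [->|//].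
by case: (q =P p) => [-> //|_]; rewrite eqxx.
Qed.

Lemma swapf_l F p q : swapf F p q p = F q.
Proof. by rewrite /swapf eqxx. Qed.

Lemma swapf_r F p q : swapf F p q q = F p.
Proof. by rewrite swapfC swapf_l. Qed.

Lemma swapf_out F p q x : x != p -> x != q -> swapf F p q x = F x.
Proof. by rewrite /swapf => /negbTE -> /negbTE ->. Qed.

Lemma slide_target_right la F a b :
  in_diag la (a, b.+1) -> F (a, b.+1) < F (a, b) ->
  (in_diag la (a.+1, b) -> F (a, b.+1) <= F (a.+1, b)) ->
  slide_target la F (a, b) = Some (a, b.+1).
Proof.
move=> h1 h2 h3; rewrite /slide_target /= h1; case: ifP => [/h3 h|_]; last by rewrite h2.
by rewrite [F (a.+1, b) < _]ltnNge h /= h2.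
Qed.

Lemma slide_target_down la F a b :
  in_diag la (a.+1, b) -> F (a.+1, b) < F (a, b) ->
  (in_diag la (a, b.+1) -> F (a.+1, b) < F (a, b.+1)) ->
  slide_target la F (a, b) = Some (a.+1, b).
Proof.
move=> h1 h2 h3; rewrite /slide_target /= h1; case: ifP => [/h3 h|_]; last by rewrite h2.
by rewrite h h2.
Qed.

Variant slide_target_spec la F a b : option (nat * nat) -> Prop :=
| SlideRight of in_diag la (a, b.+1) & F (a, b.+1) < F (a, b) &
   (in_diag la (a.+1, b) -> F (a, b.+1) <= F (a.+1, b)) :
   slide_target_spec la F a b (Some (a, b.+1))
| SlideDown of in_diag la (a.+1, b) & F (a.+1, b) < F (a, b) &
   (in_diag la (a, b.+1) -> F (a.+1, b) < F (a, b.+1)) :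
   slide_target_spec la F a b (Some (a.+1, b))
| SlideStop of (in_diag la (a, b.+1) -> F (a, b) <= F (a, b.+1)) &
   (in_diag la (a.+1, b) -> F (a, b) <= F (a.+1, b)) :
   slide_target_spec la F a b None.

Lemma slide_targetP la F a b : slide_target_spec la F a b (slide_target la F (a, b)).
Proof.
rewrite /slide_target /=; case: ifP => h1; case: ifP => h2.
- case: (ltnP (F (a.+1, b)) (F (a, b.+1))) => h3; case: ltnP => h4; constructor => // _.
    by apply: leq_trans h4 (ltnW h3).
  by apply: leq_trans h4 h3.
- by case: ltnP => h4; constructor; rewrite ?h1 ?h2.
- by case: ltnP => h4; constructor; rewrite ?h1 ?h2.
- by constructor; rewrite ?h1 ?h2.
Qed.

(** * How one exchange affects the reverse slide paths *)

Section PointerChange.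
Variable j : nat.

(** The reverse path from the new hole first returns to [(a, b)], because the entry moved there is
    at least the upper neighbour of [(a, b+1)]. From there on it reads only cells that the exchange
    left alone. *)
Lemma exitcol_right F a b k : j <= b -> 0 < k <= a ->
  F (a.-1, b.+1) <= F (a, b.+1) ->
  exitcol j (swapf F (a, b) (a, b.+1)) a b.+1 k = exitcol j F a b k.
Proof.
move=> jb; case: k => // k /andP[_ ka] h /=.
have -> : b.+1 <= j = false by lia.
rewrite /= swapf_l swapf_out; last 2 first.
- by apply/eqP => - [] ; lia.
- by apply/eqP => - [] ; lia.
rewrite ltnNge h /= (@upcol_ext j _ F); last first.
  by move=> x h1 h2; split; rewrite swapf_out //; apply/eqP => - []; lia.
apply: exitcol_ext; first by lia.
by move=> a' x h1 h2 h3; split; rewrite swapf_out //; apply/eqP => - []; lia.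
Qed.

Lemma exitcol_down F a b k : j <= b -> k <= a ->
  (j < b -> F (a.+1, b.-1) < F (a.+1, b)) ->
  exitcol j (swapf F (a, b) (a.+1, b)) a.+1 b k.+1 = exitcol j F a b k.
Proof.
move=> jb ka h /=.
have -> : upcol j (swapf F (a, b) (a.+1, b)) a.+1 b = b.
  case: b jb h => //= b jb h; have [//|jb'] /= := leqP b.+1 j.
  by rewrite swapf_l swapf_out ?h //; apply/eqP => - []; lia.
apply: exitcol_ext; first by lia.
by move=> a' x h1 h2 h3; split; rewrite swapf_out //; apply/eqP => - []; lia.
Qed.

(** In terms of [upcol_leP], the two sides differ by the inequality at column [b+1] only. The last
    hypothesis supplies it; it holds because the slide preferred the right neighbour to the lower
    one. *)
Lemma below_right F a b h c : j <= b -> a < h ->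
  (b < exitcol j F h c (h - a).-1 -> F (a, b.+1) <= F (a.+1, b)) ->
  exitcol j F h c (h - a) <= b <->
  exitcol j (swapf F (a, b) (a, b.+1)) h c (h - a) <= b.+1.
Proof.
move=> jb ah hb; have -> : h - a = (h - a).-1.+1 by lia.
rewrite !exitcolS -(@exitcol_ext j F (swapf F (a, b) (a, b.+1))); first last.
- by move=> a' x h1 h2 h3; split; rewrite swapf_out //; apply/eqP => - []; lia.
- by lia.
have -> : h - (h - a).-1 = a.+1 by lia.
set D := exitcol _ _ _ _ _ in hb *; split=> H.
  apply/upcol_leP => [|x h1 h2]; first by lia.
  rewrite !swapf_out; try (by apply/eqP => - []; lia).
  by apply: ((@upcol_leP j F a.+1 D b jb).1 H) => //; lia.
apply/upcol_leP => // x h1 h2.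
have [xb|xb] := ltnP b.+1 x; last first.
  have -> : x = b.+1 by lia.
  by apply: hb; lia.
have := (@upcol_leP j _ a.+1 D b.+1 (leqW jb)).1 H x xb h2.
by rewrite !swapf_out; try (by apply/eqP => - []; lia).
Qed.

Lemma below_down F a b h c : j <= b -> a.+1 < h ->
  exitcol j F h c (h - a.+1) <= b <->
  exitcol j (swapf F (a, b) (a.+1, b)) h c (h - a.+1) <= b.
Proof.
move=> jb ah; have -> : h - a.+1 = (h - a.+1).-1.+1 by lia.
rewrite !exitcolS -(@exitcol_ext j F (swapf F (a, b) (a.+1, b))); first last.
- by move=> a' x h1 h2 h3; split; rewrite swapf_out //; apply/eqP => - []; lia.
- by lia.
have -> : h - (h - a.+1).-1 = a.+2 by lia.
set D := exitcol _ _ _ _ _; split=> H.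
  apply/upcol_leP => // x h1 h2.
  rewrite !swapf_out; try (by apply/eqP => - []; lia).
  by apply: ((@upcol_leP j F a.+2 D b jb).1 H).
apply/upcol_leP => // x h1 h2.
have := (@upcol_leP j _ a.+2 D b jb).1 H x h1 h2.
by rewrite !swapf_out; try (by apply/eqP => - []; lia).
Qed.

End PointerChange.

(** * Single exchanges and their inverses *)

Section HoleMoves.
Variables (n : nat) (la : seq nat).
Hypothesis hla : is_partition n la.
Variables (i j : nat).

Notation state := (filling * (nat * nat))%type.

Definition diag_inj (F : filling) : Prop :=
  forall x y, in_diag la x -> in_diag la y -> F x = F y -> x = y.

(** All comparable pairs are compared, not just neighbours, so that cells separated by the hole [p]
    stay ordered. *)
Definition sorted_off (F : filling) (p : nat * nat) : Prop :=
  forall x y, region la i j x -> region la i j y -> x != p -> y != p ->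
    cell_le x y -> x != y -> F x < F y.

Definition low_at (F : filling) (p : nat * nat) : Prop :=
  forall x, region la i j x -> x != p -> cell_le x p -> F x < F p.

Record hole_sorted (F : filling) (p : nat * nat) : Prop := HoleSorted {
  hs_reg : region la i j p;
  hs_inj : diag_inj F;
  hs_sort : sorted_off F p;
  hs_low : low_at F p }.

Lemma diag_inj_swap F p q : in_diag la p -> in_diag la q ->
  diag_inj F -> diag_inj (swapf F p q).
Proof.
move=> dp dq Fi x y dx dy; rewrite /swapf.
case: (x =P p) => [xp|xp]; case: (y =P p) => [yp|yp]; subst => //.
- case: (y =P q) => [->|yq] /Fi; first by move=> ->.
  by move=> e; case: yq; rewrite e.
- case: (x =P q) => [->|xq] /Fi; first by move=> ->.
  by move=> e; case: xq; rewrite e.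
- case: (x =P q) => [->|xq]; case: (y =P q) => [->|yq] // /Fi e; last exact: e.
    by case: yp; rewrite -e.
  by case: xp; rewrite e.
Qed.

Lemma hole_forward F p q :
  hole_sorted F p -> region la i j q -> cell_le p q -> p != q -> F q < F p ->
  (forall y, region la i j y -> y != p -> cell_le p y -> F q <= F y) ->
  hole_sorted (swapf F p q) q.
Proof.
move=> [rp Fi Fs Fl] rq pq npq Fqp Fm.
have dp : in_diag la p by case/andP: rp.
have dq : in_diag la q by case/andP: rq.
split=> //; first exact: diag_inj_swap.
- move=> x y rx ry xq yq xy nxy.
  have [xp|xp] := eqVneq x p.
    subst x; have nyp : y != p by rewrite eq_sym.
    rewrite swapf_l swapf_out // ltn_neqAle Fm // andbT.
    apply/eqP => /Fi e; case/eqP: yq; symmetry; apply: e => //; by case/andP: ry.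
  have [yp|yp] := eqVneq y p.
    subst y; rewrite swapf_l swapf_out //; apply: Fs => //; first by rewrite eq_sym.
    exact: cell_le_trans pq.
  by rewrite !swapf_out //; apply: Fs.
- move=> x rx xq xq'; rewrite swapf_r.
  have [->|xp] := eqVneq x p; first by rewrite swapf_l.
  by rewrite swapf_out //; apply: ltn_trans Fqp; apply: Fs => //; rewrite eq_sym.
Qed.

Lemma hole_backward F p q :
  hole_sorted F q -> region la i j p -> cell_le p q -> p != q ->
  (forall x, region la i j x -> x != q -> cell_le x q -> F x <= F p) ->
  hole_sorted (swapf F q p) p.
Proof.
move=> [rq Fi Fs Fl] rp pq npq Fm.
have dp : in_diag la p by case/andP: rp.
have dq : in_diag la q by case/andP: rq.
split=> //; first exact: diag_inj_swap.
- move=> x y rx ry xp yp xy nxy.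
  have [xq|xq] := eqVneq x q.
    subst x; have nyq : y != q by rewrite eq_sym.
    rewrite swapf_l swapf_out //; apply: Fs => //; last by rewrite eq_sym.
    exact: cell_le_trans xy.
  have [yq|yq] := eqVneq y q.
    subst y; rewrite swapf_l swapf_out // ltn_neqAle Fm // andbT.
    apply/eqP => /Fi e; case/eqP: xp; apply: e => //; by case/andP: rx.
  by rewrite !swapf_out //; apply: Fs.
- move=> x rx xp xp'; rewrite swapf_r swapf_out //.
    apply: Fl => //; last exact: cell_le_trans pq.
    by apply: contra_neq npq => xq; apply: cell_le_anti => //; rewrite -xq.
  by apply: contra_neq npq => xq; apply: cell_le_anti => //; rewrite -xq.
Qed.

(** In row [i], right of column [j], the step is forced to the left: a cell above may belong to the
    region, but the slide to be undone started at [(i, j)]. *)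
Definition rtarget (F : filling) (q : nat * nat) : nat * nat :=
  if (q.2 <= j) || (i < q.1) && (F (q.1, q.2.-1) < F (q.1.-1, q.2))
  then (q.1.-1, q.2) else (q.1, q.2.-1).

Definition fstep (s : state) : state :=
  if slide_target la s.1 s.2 is Some q then (swapf s.1 s.2 q, q) else s.

Definition bstep (s : state) : state :=
  let p := rtarget s.1 s.2 in (swapf s.1 s.2 p, p).

Notation l := (col_height la j).
Notation E := (col_height la j).-1.

(** A hook function assigns to row [h] of column [j] a number between minus the
    leg and the arm of the cell [(h, j)]. It is shifted here to a natural number
    [v], which designates the cell of row [h] in column [v + h + j - E]; if
    [v + h < E] the number is negative and designates no cell. The shift is by
    the content, so that the update of the hook function of Novelli, Pak and
    Stoyanovskii inserts one entry and leaves the others unchanged. Hence [m],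
    the list without the entry of the current row [p.1], is constant during a
    slide; its entries above and below that row are indexed by [g - i] and
    [(h - i).-1]. The path from [p] passes to the right of the cells designated
    above it, and the paths from those below it enter row [p.1] to its left. *)
Record hooks_inv (m : seq nat) (F : filling) (p : nat * nat) : Prop := HooksInv {
  hi_row : i <= p.1;
  hi_root : 0 < i -> exitcol j F p.1 p.2 (p.1 - i).+1 <= j;
  hi_above : forall g, i <= g < p.1 ->
    nth 0 m (g - i) + g + j < exitcol j F p.1 p.2 (p.1 - g) + E;
  hi_below : forall h, p.1 < h < l -> E <= nth 0 m (h - i).-1 + h ->
    exitcol j F h (nth 0 m (h - i).-1 + h + j - E) (h - p.1) <= p.2;
  hi_bound : forall h, i < h < l -> nth 0 m (h - i).-1 + h + j < nth 0 la h + E }.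

End HoleMoves.

Arguments exitcol : simpl never.
Arguments upcol : simpl never.

(** * A slide step and its reverse preserve the hook invariant *)

Section HoleSteps.
Variables (n : nat) (la : seq nat).
Hypothesis hla : is_partition n la.
Variables (i j : nat).
Notation l := (col_height la j).
Notation E := (col_height la j).-1.
Notation hooks_inv := (hooks_inv la i j).
Notation hole_sorted := (hole_sorted la i j).
Notation rtarget := (rtarget i j).

Lemma below_diag F h c a b k : c < nth 0 la h -> a <= h -> b <= exitcol j F h c k ->
  in_diag la (a, b).
Proof.
move=> h1 h2 h3; rewrite /in_diag /=; have := exitcol_le j F h c k; have := row_le hla h2; lia.
Qed.

(** Stated as an equivalence, like [hooks_down], so that the forward and the backward step can share
    it. *)
Lemma hooks_right m F a b : j <= b -> i <= a ->
  (0 < a -> F (a.-1, b.+1) <= F (a, b.+1)) ->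
  (in_diag la (a.+1, b) -> F (a, b.+1) <= F (a.+1, b)) ->
  hooks_inv m F (a, b) <-> hooks_inv m (swapf F (a, b) (a, b.+1)) (a, b.+1).
Proof.
move=> jb ia C1 C2.
have hb h v : a < h -> v < nth 0 la h ->
    (b < exitcol j F h v (h - a).-1 -> F (a, b.+1) <= F (a.+1, b)).
  by move=> ah vh hv; apply: C2; apply: below_diag vh ah (ltnW hv).
split=> -[_ r A B bd]; split=> //=; rewrite /= in r A B; try exact: leqW.
- by move=> i0; rewrite exitcol_right ?C1 ?r //; lia.
- by move=> g hg; rewrite exitcol_right ?C1 ?A //; lia.
- move=> h hh cd; apply: (below_right _ _ _).1; [by []|lia| |exact: B].
  by apply: hb; [lia|have := bd h; lia].
- by move=> i0; rewrite -exitcol_right ?C1 ?r //; lia.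
- by move=> g hg; rewrite -exitcol_right ?C1 ?A //; lia.
- move=> h hh cd; apply: (below_right _ _ _).2; [by []|lia| |exact: B].
  by apply: hb; [lia|have := bd h; lia].
Qed.

Lemma hooks_down m F a b : j <= b -> i <= a -> in_diag la (a.+1, b) ->
  (j < b -> F (a.+1, b.-1) < F (a.+1, b)) ->
  (in_diag la (a, b.+1) -> F (a.+1, b) < F (a, b.+1)) ->
  hooks_inv m F (a, b) <-> hooks_inv m (swapf F (a, b) (a.+1, b)) (a.+1, b).
Proof.
move=> jb ia dq C1 C2.
have al : a.+1 < l by rewrite (ltn_col_height hla); move: dq; rewrite /in_diag /=; lia.
split=> -[_ r A B bd]; split=> //=; rewrite /= in r A B; try exact: leqW.
- move=> i0; have -> : (a.+1 - i).+1 = (a - i).+2 by lia.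
  by rewrite exitcol_down ?r //; lia.
- move=> g hg; have -> : a.+1 - g = (a - g).+1 by lia.
  rewrite exitcol_down //; last by lia.
  have [ga|ga] := ltnP g a; first by apply: A; lia.
  (* The one real change: the entry with index [a - i] no longer designates a cell of row [a+1] but
     one of row [a], one column further left. Its old path left row [a+1] in column at most [b]; as
     [F (a+1, b) < F (a, b+1)], that path cannot have started beyond [b]. *)
  have eg : g = a by lia.
  subst g; rewrite subnn [exitcol _ _ _ _ 0]/exitcol; have := B a.+1; have := bd a.+1.
  have -> : (a.+1 - i).-1 = a - i by lia.
  set v := nth 0 m (a - i) => hbd hB.
  have [vE|vE] := leqP E (v + a.+1); last by lia.
  have := hB ltac:(lia) vE; rewrite subSnn exitcolS subn0 [exitcol _ _ _ _ 0]/exitcol.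
  move=> /(upcol_leP _ _ _ jb).1 H.
  have [|vb] := leqP (v + a.+1 + j - E) b; first by lia.
  have := H b.+1 (ltnSn _) vb; rewrite /= leqNgt C2 //.
  apply: (in_diag_le hla (y := (a.+1, v + a.+1 + j - E))) => //=.
  by rewrite /in_diag /=; have := hbd ltac:(lia); lia.
- move=> h hh cd; apply: (below_down F _ jb _).1 => //; first by lia.
  have := B h ltac:(lia) cd; have -> : h - a = (h - a.+1).+1 by lia.
  rewrite exitcolS; have -> : h - (h - a.+1) = a.+1 by lia.
  set c := _ + _ - _; set D := exitcol _ _ _ _ _ => /(upcol_leP _ _ _ jb).1 H.
  rewrite leqNgt; apply/negP => bD.
  have := H b.+1 (ltnSn _) bD; rewrite /= leqNgt C2 //.
  have ch : c < nth 0 la h by rewrite /c; have := bd h; lia.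
  by apply: (below_diag ch _ bD); lia.
- move=> i0; have := r i0; have -> : (a.+1 - i).+1 = (a - i).+2 by lia.
  by rewrite exitcol_down //; lia.
- move=> g hg; have := A g; have -> : a.+1 - g = (a - g).+1 by lia.
  by rewrite exitcol_down //; lia.
- move=> h hh cd.
  have [ah|ah] := ltnP a.+1 h; last first.
    have eh : h = a.+1 by lia.
    subst h; have := A a; rewrite subSnn exitcol_down //.
    have -> : (a.+1 - i).-1 = a - i by lia.
    rewrite [exitcol _ _ _ _ 0]/exitcol => H.
    apply: leq_trans (exitcol_le _ _ _ _ _) _; lia.
  have -> : h - a = (h - a.+1).+1 by lia.
  rewrite exitcolS; apply: leq_trans (upcol_le _ _ _ _) _.
  by apply: (below_down F _ jb _).2 => //; apply: B; lia.
Qed.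

Lemma regP (x : nat * nat) : region la i j x -> in_diag la x /\ (j < x.2 \/ x.2 = j /\ i <= x.1).
Proof. by case/andP=> -> /orP[|/andP[/eqP -> ->]]; auto. Qed.

Lemma sorted_off_le F p x y : sorted_off la i j F p ->
  region la i j x -> region la i j y -> x != p -> y != p -> cell_le x y -> F x <= F y.
Proof.
by move=> Fs rx ry xp yp xy; have [->//|nxy] := eqVneq x y; apply/ltnW/Fs.
Qed.

(** A cell beyond the hole lies weakly beyond one of the two neighbours of the hole. Hence the
    smaller neighbour is the minimum that [hole_forward] asks for. *)
Lemma above_hole F a b y : sorted_off la i j F (a, b) -> region la i j (a, b) ->
  region la i j y -> y != (a, b) -> cell_le (a, b) y ->
  region la i j (a, b.+1) /\ F (a, b.+1) <= F y \/ region la i j (a.+1, b) /\ F (a.+1, b) <= F y.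
Proof.
case: y => c d Fs /regP[dp rp] ry; have [dy _] := regP ry.
rewrite /cell_le /= in rp * => yp /andP[ac bd].
have [bd'|bd'] := ltnP b d; [left|right].
  have r : region la i j (a, b.+1).
    by rewrite /region (in_diag_le hla (y := (c, d))) //=; lia.
  split=> //; apply: sorted_off_le ry _ yp _ => //; first by apply/eqP => - []; lia.
  by rewrite /cell_le /=; lia.
have ac' : a < c.
  by move/eqP: yp => yp; apply/contraT => h; case: yp; congr pair; lia.
have r : region la i j (a.+1, b) by rewrite /region (in_diag_le hla (y := (c, d))) //=; lia.
split=> //; apply: sorted_off_le ry _ yp _ => //; first by apply/eqP => - []; lia.
by rewrite /cell_le /= bd andbT.
Qed.

Lemma hole_target F p q : hole_sorted F p -> slide_target la F p = Some q ->
  hole_sorted (swapf F p q) q.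
Proof.
case: p => a b hs; have [rp Fi Fs Fl] := hs; have [dp /= rp'] := regP rp.
case: (slide_targetP la F a b) => // h1 h2 h3 [<-] {q}; apply: hole_forward => //.
- by rewrite /region h1 /=; lia.
- by rewrite /cell_le /=; lia.
- by apply/eqP => - []; lia.
- move=> y ry yp py; case: (above_hole Fs rp ry yp py) => -[r //]; apply: leq_trans.
  by apply: h3; case/andP: r.
- by rewrite /region h1 /=; lia.
- by rewrite /cell_le /=; lia.
- by apply/eqP => - []; lia.
- move=> y ry yp py; case: (above_hole Fs rp ry yp py) => -[r //]; apply: leq_trans.
  by apply/ltnW/h3; case/andP: r.
Qed.

Lemma forward_step m F p q :
  hole_sorted F p -> hooks_inv m F p -> slide_target la F p = Some q ->
  [/\ hole_sorted (swapf F p q) q, hooks_inv m (swapf F p q) q,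
      rtarget (swapf F p q) q = p & hprime q = (hprime p).+1].
Proof.
case: p => a b hs hi st; have ht := hole_target hs st; move: st.
have [rp Fi Fs Fl] := hs; have /= ia := hi_row hi.
have [dp rp'] := regP rp; rewrite /= in rp'.
have jb : j <= b by lia.
case: (slide_targetP la F a b) => // h1 h2 h3 [eq]; subst q.
- have rq : region la i j (a, b.+1) by rewrite /region h1 /=; lia.
  have C1 : 0 < a -> F (a.-1, b.+1) <= F (a, b.+1).
    move=> a0; apply/ltnW/Fs => //.
    + rewrite /region (in_diag_le hla (y := (a, b.+1))) //=; lia.
    + by apply/eqP => - []; lia.
    + by apply/eqP => - []; lia.
    + by rewrite /cell_le /=; lia.
    + by apply/eqP => - []; lia.
  split.
  + exact: ht.
  + by apply: ((hooks_right m jb ia C1 h3).1 hi).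
  + rewrite /rtarget /=; case: ifP => //.
    move=> /orP[|/andP[h]]; first by lia.
    rewrite swapf_l swapf_out; [|by apply/eqP => - []; lia..].
    by rewrite ltnNge C1 //; lia.
  + by rewrite /hprime /= addnS.
- have rq : region la i j (a.+1, b) by rewrite /region h1 /=; lia.
  have C1 : j < b -> F (a.+1, b.-1) < F (a.+1, b).
    move=> a0; apply/Fs => //.
    + rewrite /region (in_diag_le hla (y := (a.+1, b))) //=; lia.
    + by apply/eqP => - []; lia.
    + by apply/eqP => - []; lia.
    + by rewrite /cell_le /=; lia.
    + by apply/eqP => - []; lia.
  split.
  + exact: ht.
  + by apply: ((hooks_down m jb ia h1 C1 h3).1 hi).
  + rewrite /rtarget /=; case: ifP => // /negbT.
    rewrite negb_or -ltnNge => /andP[jb' /negP []].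
    rewrite swapf_l swapf_out; [|by apply/eqP => - []; lia..].
    by rewrite C1 // andbT; lia.
  + by rewrite /hprime /= addSn.
Qed.

Lemma backward_step m F q :
  hole_sorted F q -> hooks_inv m F q -> q != (i, j) ->
  let p := rtarget F q in
  [/\ hole_sorted (swapf F q p) p, hooks_inv m (swapf F q p) p,
      slide_target la (swapf F q p) p = Some q & hprime q = (hprime p).+1].
Proof.
case: q => a b hs hi nq.
have [rq Fi Fs Fl] := hs; have /= ia := hi_row hi.
have [dq rq'] := regP rq; rewrite /= in rq'.
have jb : j <= b by lia.
rewrite /rtarget; case: ifP => /= H.
- have a0 : i < a.
    case/orP: H => [bj|/andP[] //].
    have bj' : b = j by lia.
    by move: nq; rewrite bj' ltn_neqAle ia andbT; apply: contra_neq => ->.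
  case: a a0 hs hi nq rq Fl ia dq rq' H Fs => // a a0 hs hi nq rq Fl ia dq rq' /= H Fs.
  have rp : region la i j (a, b).
    by rewrite /region (in_diag_le hla (y := (a.+1, b))) //=; lia.
  have C1 : j < b -> F (a.+1, b.-1) < F (a, b) by case/orP: H => [|/andP[_ ->]] //; lia.
  have max x : region la i j x -> x != (a.+1, b) -> cell_le x (a.+1, b) -> F x <= F (a, b).
    case: x => c d rx xq; rewrite /cell_le /= => /andP[ca db].
    have [_ rx'] := regP rx; rewrite /= in rx'.
    have [ca'|ca'] := leqP c a.
      by apply: sorted_off_le Fs rx rp xq _ _; rewrite /cell_le /= ?ca' //; apply/eqP => - []; lia.
    have bd : d < b.
      move/eqP: xq => xq; apply/contraT => h; by case: xq; congr pair; lia.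
    apply: leq_trans (ltnW (C1 _)); last by lia.
    apply: sorted_off_le Fs rx _ xq _ _.
    + by rewrite /region (in_diag_le hla (y := (a.+1, b))) //=; lia.
    + by apply/eqP => - []; lia.
    + by rewrite /cell_le /=; lia.
  have npq : (a, b) != (a.+1, b) by apply/eqP => - []; lia.
  have pq : cell_le (a, b) (a.+1, b) by rewrite /cell_le /=; lia.
  have Fp : F (a, b) < F (a.+1, b) by apply: Fl.
  have C2 : in_diag la (a, b.+1) -> F (a, b) < F (a, b.+1).
    move=> d; apply: Fs => //; try by apply/eqP => - []; lia.
      by rewrite /region d /=; lia.
    by rewrite /cell_le /=; lia.
  split.
  + by apply: hole_backward.
  + apply: (hooks_down m jb _ dq _ _).2; first by lia.
    * move=> jb'; rewrite swapf_l swapf_out; [|by apply/eqP => - []; lia..].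
      exact: C1.
    * move=> d; rewrite swapf_l swapf_out; [|by apply/eqP => - []; lia..].
      exact: C2.
    * by rewrite swapfK.
  + apply: slide_target_down => //; first by rewrite swapf_l swapf_r.
    by move=> d; rewrite swapf_l swapf_out; [exact: C2|by apply/eqP => - []; lia..].
  + by rewrite /hprime /= addSn.
- have jb1 : j < b by have /norP[] := negbT H; rewrite -ltnNge.
  case: b jb1 jb hs hi nq rq Fl dq rq' H Fs => // b jb1 jb hs hi nq rq Fl dq rq' /= H Fs.
  have rp : region la i j (a, b).
    by rewrite /region (in_diag_le hla (y := (a, b.+1))) //=; lia.
  have C1 : 0 < a -> F (a.-1, b.+1) <= F (a, b).
    move=> a0; have [ia'|ia'] := ltnP i a; first by move: H; rewrite ia' /=; lia.
    (* In row [i] the reverse step made no comparison. That the left entry is at least the upper one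
       follows from [hi_root]: the path leaves row [i] in column [j], so it turned left here. *)
    have ea : a = i by lia.
    subst a; have /= := hi_root hi a0; rewrite subnn exitcolS subn0 [exitcol _ _ _ _ 0]/exitcol.
    by move=> /(upcol_leP _ _ _ (leqnn _)).1 /(_ b.+1); apply; lia.
  have max x : region la i j x -> x != (a, b.+1) -> cell_le x (a, b.+1) -> F x <= F (a, b).
    case: x => c d rx xq; rewrite /cell_le /= => /andP[ca db].
    have [_ rx'] := regP rx; rewrite /= in rx'.
    have [db'|db'] := leqP d b.
      by apply: sorted_off_le Fs rx rp xq _ _; rewrite /cell_le /= ?db' ?andbT //;
        apply/eqP => - []; lia.
    have ca' : c < a.
      move/eqP: xq => xq; apply/contraT => h; by case: xq; congr pair; lia.
    apply: leq_trans (C1 _); last by lia.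
    apply: sorted_off_le Fs rx _ xq _ _.
    + by rewrite /region (in_diag_le hla (y := (a, b.+1))) //=; lia.
    + by apply/eqP => - []; lia.
    + by rewrite /cell_le /=; lia.
  have npq : (a, b) != (a, b.+1) by apply/eqP => - []; lia.
  have pq : cell_le (a, b) (a, b.+1) by rewrite /cell_le /=; lia.
  have Fp : F (a, b) < F (a, b.+1) by apply: Fl.
  have C2 : in_diag la (a.+1, b) -> F (a, b) < F (a.+1, b).
    move=> d; apply: Fs => //; try by apply/eqP => - []; lia.
      by rewrite /region d /=; lia.
    by rewrite /cell_le /=; lia.
  split.
  + by apply: hole_backward.
  + apply: (hooks_right m _ ia _ _).2; first by lia.
    * move=> a0; rewrite swapf_l swapf_out; [|by apply/eqP => - []; lia..].
      exact: C1.
    * move=> d; rewrite swapf_l swapf_out; [|by apply/eqP => - []; lia..].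
      exact/ltnW/C2.
    * by rewrite swapfK.
  + apply: slide_target_right => //; first by rewrite swapf_l swapf_r.
    move=> d; rewrite swapf_l swapf_out; [exact/ltnW/C2|by apply/eqP => - []; lia..].
  + by rewrite /hprime /= addnS.
Qed.

End HoleSteps.

(** * Hook lists and the slide bijection within a column *)

Definition insert_at (k v : nat) (s : seq nat) : seq nat := take k s ++ v :: drop k s.
Definition remove_at (k : nat) (s : seq nat) : seq nat := take k s ++ drop k.+1 s.

Lemma nth_insert_at k v s t : k <= size s ->
  nth 0 (insert_at k v s) t =
    if t < k then nth 0 s t else if t == k then v else nth 0 s t.-1.
Proof.
move=> ks; rewrite nth_cat size_take_min (minn_idPl ks); case: ltnP => tk.
  by rewrite nth_take.
case: eqP => [->|tk']; first by rewrite subnn.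
have -> : t - k = (t - k).-1.+1 by lia.
by rewrite /= nth_drop; congr nth; lia.
Qed.

Lemma nth_remove_at k s t : k < size s ->
  nth 0 (remove_at k s) t = if t < k then nth 0 s t else nth 0 s t.+1.
Proof.
move=> ks; rewrite nth_cat size_take ks; case: ltnP => tk; first by rewrite nth_take.
by rewrite nth_drop; congr nth; lia.
Qed.

Lemma size_insert_at k v s : size (insert_at k v s) = (size s).+1.
Proof. by rewrite size_cat /= addnS -size_cat cat_take_drop. Qed.

Lemma size_remove_at k s : k < size s -> size (remove_at k s) = (size s).-1.
Proof. by move=> ks; rewrite size_cat size_take ks size_drop; lia. Qed.

Lemma insert_remove_at k s : k < size s -> insert_at k (nth 0 s k) (remove_at k s) = s.
Proof.
move=> ks; apply: (@eq_from_nth _ 0); first by rewrite size_insert_at size_remove_at //; lia.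
move=> t _; rewrite nth_insert_at ?size_remove_at //; last by lia.
rewrite !nth_remove_at //; case: ltnP => // kt; case: eqP => [->//|kt'].
have -> : (t.-1 < k) = false by lia.
by congr nth; lia.
Qed.

Lemma remove_insert_at k v s : k <= size s -> remove_at k (insert_at k v s) = s.
Proof.
move=> ks; apply: (@eq_from_nth _ 0); rewrite size_remove_at ?size_insert_at //.
move=> t _; rewrite nth_remove_at ?size_insert_at // !nth_insert_at //.
case: ltnP => // kt; have -> : (t.+1 < k) = false by lia.
by have -> : (t.+1 == k) = false by lia.
Qed.

Section ColumnBijection.
Variables (n : nat) (la : seq nat).
Hypothesis hla : is_partition n la.
Variables (i j : nat).
Hypothesis il : i < col_height la j.
Notation state := (filling * (nat * nat))%type.
Notation l := (col_height la j).
Notation E := (col_height la j).-1.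

Definition sorted_from (i j : nat) (F : filling) : Prop :=
  forall x y, region la i j x -> region la i j y -> cell_le x y -> x != y -> F x < F y.

Definition hook_entry (i : nat) (M : seq nat) (h : nat) : nat := nth 0 M (h - i).
Definition hook_col (i : nat) (M : seq nat) (h : nat) : nat := hook_entry i M h + h + j - E.

Record hook_list (i : nat) (F : filling) (M : seq nat) : Prop := HookList {
  hl_size : size M = l - i;
  hl_bound : forall h, i <= h < l -> hook_entry i M h + h + j < nth 0 la h + E;
  hl_root : forall h, 0 < i -> i <= h < l -> E <= hook_entry i M h + h ->
    exitcol j F h (hook_col i M h) (h - i).+1 <= j }.

(** The row of the designated cell whose reverse path is furthest to the top
    right: this recovers the end of the last slide from the hook list. *)
Record best_row (F : filling) (M : seq nat) (a : nat) : Prop := BestRow {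
  br_range : i <= a < l;
  br_cand : E <= hook_entry i M a + a;
  br_above : forall g, i <= g < a ->
    hook_entry i M g + g + j < exitcol j F a (hook_col i M a) (a - g) + E;
  br_below : forall h, a < h < l -> E <= hook_entry i M h + h ->
    exitcol j F h (hook_col i M h) (h - a) <= hook_col i M a }.

(** For [a1 < a2], the path from row [a2] would enter row [a1] both weakly left and strictly right
    of the cell designated there. *)
Lemma best_row_uniq F M a1 a2 : best_row F M a1 -> best_row F M a2 -> a1 = a2.
Proof.
wlog: a1 a2 / a1 < a2 => [H b1 b2|a12].
  by case: (ltngtP a1 a2) => // h; [|symmetry]; apply: H.
move=> [r1 c1 _ B1] [r2 c2 A2 _].
have := B1 a2 ltac:(lia) c2; have := A2 a1 ltac:(lia).
rewrite [hook_col i M a1]/hook_col; lia.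
Qed.

Lemma best_row_exists F M : exists a, best_row F M a.
Proof.
suff [a [h1 h2 h3 h4]] : exists a, [/\ i <= a < l, E <= hook_entry i M a + a,
   forall g, i <= g < a ->
    hook_entry i M g + g + j < exitcol j F a (hook_col i M a) (a - g) + E &
   forall h, a < h < l -> E <= hook_entry i M h + h ->
    exitcol j F h (hook_col i M h) (h - a) <= hook_col i M a] by exists a.
suff H d : d <= E - i -> exists a, [/\ E - d <= a < l, E <= hook_entry i M a + a,
   forall g, E - d <= g < a ->
    hook_entry i M g + g + j < exitcol j F a (hook_col i M a) (a - g) + E &
   forall h, a < h < l -> E <= hook_entry i M h + h ->
    exitcol j F h (hook_col i M h) (h - a) <= hook_col i M a].
  by have := H (E - i) (leqnn _); have -> : E - (E - i) = i by lia.
elim: d => [_|d IH dE].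
  (* The bottom row [E] of the column always designates a cell, since its leg is zero. *)
  by exists E; split=> [||g|h]; lia.
have [a [h1 h2 h3 h4]] := IH ltac:(lia).
set g := E - d.+1; have gd : g.+1 = E - d by rewrite /g; lia.
(* Reverse paths do not cross, so a row [g] that beats the current best row [a]
   also beats every row [h] that [a] beats. *)
have [C|C] := ltnP (hook_entry i M g + g + j) (exitcol j F a (hook_col i M a) (a - g) + E).
  exists a; split=> // [|g' hg']; first by lia.
  have [->//|gg] := eqVneq g' g; apply: h3; lia.
have jc : j <= hook_col i M a by rewrite /hook_col; lia.
have je := exitcol_ge F a (a - g) jc.
have cg : hook_col i M g = hook_entry i M g + g + j - E by [].
exists g; split=> [||g'|h hg cd]; try lia.
apply: leq_trans (_ : exitcol j F a (hook_col i M a) (a - g) <= _); last by lia.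
have [ah|ha|ha] := ltngtP a h.
- have -> : h - g = (h - a) + (a - g) by lia.
  rewrite exitcolD; have -> : h - (h - a) = a by lia.
  by apply: exitcol_mono; apply: h4; lia.
- have -> : a - g = (a - h) + (h - g) by lia.
  rewrite exitcolD; have -> : a - (a - h) = h by lia.
  apply: exitcol_mono; have := h3 h ltac:(lia); rewrite {2}/hook_col; lia.
- by subst h.
Qed.

Lemma hole_start F : sorted_from i.+1 j F -> diag_inj la F -> hole_sorted la i j F (i, j).
Proof.
move=> Fs Fi.
have sub x : region la i j x -> x != (i, j) -> region la i.+1 j x.
  case: x => a b /regP[/= d r] /eqP ne; rewrite /region d /=.
  by apply/contraT => h; case: ne; congr pair; lia.
split=> //.
- rewrite /region eqxx leqnn orbT andbT /in_diag /= -(ltn_col_height hla); exact: il.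
- by move=> x y rx ry xp yp xy nxy; apply: Fs => //; apply: sub.
- move=> [a b] /regP[/= d r] /eqP ne; rewrite /cell_le /= => /andP[h1 h2].
  by case: ne; congr pair; lia.
Qed.

Lemma sorted_from_step F : hole_sorted la i j F (i, j) -> sorted_from i.+1 j F.
Proof.
move=> [rp Fi Fs Fl].
have sub x : region la i.+1 j x -> region la i j x /\ x != (i, j).
  case: x => a b /regP[/= d r]; split; first by rewrite /region d /=; lia.
  by apply/eqP => - []; lia.
by move=> x y /sub[rx xp] /sub[ry yp] xy nxy; apply: Fs.
Qed.

(** Hook lists for the rows from [i+1] on are constrained by where the reverse paths enter row [i].
    With the hole at [(i, j)] this is exactly the invariant for the rows below the hole, and the
    other parts are trivial. *)
Lemma hooks_start m F : size m = l - i.+1 ->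
  hooks_inv la i j m F (i, j) <-> hook_list i.+1 F m.
Proof.
move=> sm.
have e h : nth 0 m (h - i).-1 = hook_entry i.+1 m h by rewrite /hook_entry; congr nth; lia.
split=> [[/= _ r A B bd]|[_ bd r]]; split=> //=.
- by move=> h hh; rewrite -e; apply: bd; lia.
- move=> h _ hh; rewrite -e => cd; have := B h ltac:(lia) cd; rewrite /= e /hook_col.
  by have -> : (h - i.+1).+1 = h - i by lia.
- by move=> _; rewrite subnn exitcolS subn0; apply: upcol_le.
- by move=> g; lia.
- move=> h hh; rewrite e => cd; have := r h (ltn0Sn _) ltac:(lia) cd; rewrite /hook_col.
  by have -> : (h - i.+1).+1 = h - i by lia.
- by move=> h hh; rewrite e; apply: bd; lia.
Qed.

Lemma sorted_end F p : hole_sorted la i j F p -> slide_target la F p = None ->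
  sorted_from i j F.
Proof.
case: p => a b [rp Fi Fs Fl]; have [dp _] := regP rp.
case: (slide_targetP la F a b) => // h1 h2 _ x y rx ry xy nxy.
have [yp|yp] := eqVneq y (a, b); first by subst y; apply: Fl.
have [xp|xp] := eqVneq x (a, b); last exact: Fs.
subst x; have dy : in_diag la y by case/andP: ry.
rewrite ltn_neqAle; apply/andP; split; first by apply: contra_neq nxy; apply: Fi.
case: (above_hole hla Fs rp ry yp xy) => -[/andP[r _]]; apply: leq_trans; auto.
Qed.

Lemma hole_end F p : region la i j p -> sorted_from i j F -> diag_inj la F ->
  hole_sorted la i j F p /\ slide_target la F p = None.
Proof.
case: p => a b rp Fs Fi; have [dp rp'] := regP rp; rewrite /= in rp'; split.
  split=> //; first by move=> x y rx ry _ _; apply: Fs.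
  by move=> x rx ne le; apply: Fs.
case: slide_targetP => // h1 h2 _.
- have : F (a, b) < F (a, b.+1).
    apply: Fs => //; rewrite /region ?h1 /cell_le /=; try lia.
    by apply/eqP => - []; lia.
  lia.
- have : F (a, b) < F (a.+1, b).
    apply: Fs => //; rewrite /region ?h1 /cell_le /=; try lia.
    by apply/eqP => - []; lia.
  lia.
Qed.

Definition hook_code (p : nat * nat) : nat := p.2 + E - (j + p.1).

Lemma hooks_end m F p : region la i j p -> size m = l - i.+1 -> hooks_inv la i j m F p ->
  let M := insert_at (p.1 - i) (hook_code p) m in
  [/\ hook_list i F M, best_row F M p.1 & hook_col i M p.1 = p.2].
Proof.
case: p => a b rp sm [/= ia r A B bd].
have [dp /= rp'] := regP rp.
have al : a < l by rewrite (ltn_col_height hla); move: dp; rewrite /in_diag /=; lia.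
set M := insert_at _ _ _.
have eM h : i <= h -> hook_entry i M h = if h < a then nth 0 m (h - i) else
   if h == a then hook_code (a, b) else nth 0 m (h - i).-1.
  move=> ih; rewrite /hook_entry nth_insert_at ?sm; last by lia.
  have -> : (h - i < a - i) = (h < a) by lia.
  by have -> : (h - i == a - i) = (h == a) by lia.
have eg g : i <= g < a -> hook_entry i M g = nth 0 m (g - i).
  by move=> /andP[ig ga]; rewrite eM ?ga.
have ea : hook_entry i M a + a + j = b + E.
  by rewrite eM // ltnn eqxx /hook_code /=; lia.
have eh h : a < h -> hook_entry i M h = nth 0 m (h - i).-1.
  move=> ah; rewrite eM; last by lia.
  have -> : (h < a) = false by lia.
  by have -> : (h == a) = false by lia.
have ca : hook_col i M a = b by rewrite /hook_col ea; lia.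
split=> //.
- split=> [|h hh|h i0 hh cd].
  + by rewrite size_insert_at sm; lia.
  + have [ha|ha|ha] := ltngtP h a.
    (* Above the end of the slide, row [h] holds the entry that row [h+1] had. The column drops by
       one with the row, and row [h] is at least as long as row [h+1]. *)
    * rewrite eg; last by lia.
      have := bd h.+1 ltac:(lia); have -> : (h.+1 - i).-1 = h - i by lia.
      have := row_le hla (leqnSn h); lia.
    * by rewrite eh //; apply: bd; lia.
    * by subst h; rewrite ea; move: dp; rewrite /in_diag /=; lia.
  + have [ha|ha|ha] := ltngtP h a.
    (* The path from [p] passes to the right of this cell and still leaves row [i] in column at most
       [j]; by monotonicity so does the path from this cell. *)
    * have H := A h ltac:(lia).
      apply: leq_trans (r i0).
      have -> : (a - i).+1 = (a - h) + (h - i).+1 by lia.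
      rewrite exitcolD; have -> : a - (a - h) = h by lia.
      apply: exitcol_mono; rewrite /hook_col eg //; lia.
    * have H := B h ltac:(lia).
      have -> : (h - i).+1 = (h - a) + (a - i).+1 by lia.
      rewrite exitcolD; have -> : h - (h - a) = a by lia.
      apply: leq_trans (r i0); apply: exitcol_mono.
      rewrite /hook_col eh //; apply: H; rewrite -eh //.
    * by subst h; rewrite ca; apply: r.
- split=> [||g hg|h hh cd]; first by lia.
  + by lia.
  + by rewrite ca eg //; apply: A.
  + have ah : a < h by lia.
    by rewrite ca /hook_col eh //; apply: B => //; rewrite -eh.
Qed.

Lemma hooks_best F M a : hook_list i F M -> best_row F M a ->
  let p := (a, hook_col i M a) in
  [/\ region la i j p, hooks_inv la i j (remove_at (a - i) M) F p,
      size (remove_at (a - i) M) = l - i.+1 & hook_code p = hook_entry i M a].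
Proof.
move=> [sM bd r] [ra ca A B] p.
have sk : a - i < size M by rewrite sM; lia.
have cb : hook_col i M a < nth 0 la a by rewrite /hook_col; have := bd a; lia.
have eg g : i <= g < a -> nth 0 (remove_at (a - i) M) (g - i) = hook_entry i M g.
  by move=> hg; rewrite nth_remove_at //; have -> : g - i < a - i by lia.
have eh h : a < h -> nth 0 (remove_at (a - i) M) (h - i).-1 = hook_entry i M h.
  move=> hg; rewrite nth_remove_at //; have -> : ((h - i).-1 < a - i) = false by lia.
  by rewrite /hook_entry; congr nth; lia.
split.
- by rewrite /region /in_diag /p /= cb /= /hook_col; lia.
- split=> /= [|i0|g hg|h hh|h hh]; first by lia.
  + by apply: r; lia.
  + by rewrite eg //; apply: A.
  + by rewrite eh; [apply: B|lia].
  + have [ha|ha] := leqP h a; last by rewrite eh //; apply: bd; lia.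
    have -> : (h - i).-1 = h.-1 - i by lia.
    rewrite eg; last by lia.
    have := A h.-1 ltac:(lia); have := exitcol_le j F a (hook_col i M a) (a - h.-1).
    by have := row_le hla ha; lia.
- by rewrite size_remove_at // sM; lia.
- by rewrite /hook_code /p /= /hook_col; lia.
Qed.

Notation fwd := (fstep la).
Notation bwd := (bstep i j).

(** [fstep] stands still once the slide has stopped, so [k] counts the exchanges really made. It
    equals the growth of [hprime], hence it can be read off the end cell when the slide is
    undone. *)
Lemma forward_run m (s : state) t :
  hole_sorted la i j s.1 s.2 -> hooks_inv la i j m s.1 s.2 ->
  let s' := iter t fwd s in
  [/\ hole_sorted la i j s'.1 s'.2, hooks_inv la i j m s'.1 s'.2 &
   exists k, [/\ hprime s'.2 = hprime s.2 + k, iter k bwd s' = s &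
     k = t \/ slide_target la s'.1 s'.2 = None]].
Proof.
move=> hs hi; elim: t => [|t [hs' hi' [k [k1 k2 k3]]]].
  by split=> //; exists 0; rewrite addn0; split; auto.
rewrite /= /fstep; case e : slide_target => [q|]; last first.
  by split=> //; exists k; split; auto.
have [h1 h2 h3 h4] := forward_step hla hs' hi' e.
split=> //=; exists k.+1; split.
- by rewrite h4 k1 addnS.
- rewrite iterSr; have -> // : bwd (swapf (iter t fwd s).1 (iter t fwd s).2 q, q) = iter t fwd s.
  by rewrite /bstep /= h3 swapfK; case: (iter t fwd s).
- by left; case: k3 => [->//|]; rewrite e.
Qed.

(** Each step back lowers [hprime] by one, and [(i, j)] is the only cell with value [i + j] among
    those in rows from [i] and columns from [j] on. *)
Lemma backward_run m (s : state) k :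
  hole_sorted la i j s.1 s.2 -> hooks_inv la i j m s.1 s.2 ->
  hprime s.2 = i + j + k ->
  let s' := iter k bwd s in
  [/\ hole_sorted la i j s'.1 s'.2, hooks_inv la i j m s'.1 s'.2,
   s'.2 = (i, j) & iter k fwd s' = s].
Proof.
elim: k s => [|k IH] s hs hi hk.
  split=> //=; case: s hs hi hk => F [a b] [/regP[_ /= rp] _ _ _] [/= ia _ _ _ _].
  by rewrite /hprime /= => e; congr pair; lia.
have np : s.2 != (i, j).
  by apply/eqP => e; move: hk; rewrite e /hprime /=; lia.
have [h1 h2 h3 h4] := backward_step hla hs hi np.
have [|h5 h6 h7 h8] := IH (bwd s) h1 h2; first by rewrite /=; lia.
cbv zeta; rewrite (iterSr k bwd); split=> //; rewrite (iterS k fwd) h8 /fstep /= h3 swapfK.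
by case: s {hs hi hk np h1 h2 h3 h4 h5 h6 h7 h8}.
Qed.

Definition slide_state (F : filling) : state := iter n fwd (F, (i, j)).

Definition slide_code (F : filling) (m : seq nat) : seq nat :=
  insert_at ((slide_state F).2.1 - i) (hook_code (slide_state F).2) m.

Lemma slide_codeP F m : sorted_from i.+1 j F -> diag_inj la F -> hook_list i.+1 F m ->
  let s := slide_state F in
  [/\ sorted_from i j s.1, diag_inj la s.1, hook_list i s.1 (slide_code F m) &
   [/\ best_row s.1 (slide_code F m) s.2.1,
   hook_col i (slide_code F m) s.2.1 = s.2.2,
   remove_at (s.2.1 - i) (slide_code F m) = m &
   F = (iter (hprime s.2 - (i + j)) bwd s).1]].
Proof.
move=> Fs Fi hm s.
have sm := hl_size hm.
have hs := hole_start Fs Fi.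
have hi := (hooks_start F sm).2 hm.
have [hs' hi' [k [k1 k2 k3]]] := @forward_run m (F, (i, j)) n hs hi.
have {}k3 : slide_target la s.1 s.2 = None.
  case: k3 => // kn; move: k1; rewrite /= kn.
  have /andP[d _] := hs_reg hs'; have := hprime_lt hla d; lia.
have [h1 h2 h3] := hooks_end (hs_reg hs') sm hi'.
split=> //; first exact: sorted_end hs' k3.
  exact: hs_inj hs'.
split=> //; last first.
  have -> : hprime s.2 - (i + j) = k by rewrite /s /slide_state k1 /hprime /=; lia.
  by rewrite /s /slide_state k2.
by rewrite remove_insert_at // sm; have := br_range h2; rewrite -/(slide_state F) -/s; lia.
Qed.

Lemma slide_code_inj F1 m1 F2 m2 :
  sorted_from i.+1 j F1 -> diag_inj la F1 -> hook_list i.+1 F1 m1 ->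
  sorted_from i.+1 j F2 -> diag_inj la F2 -> hook_list i.+1 F2 m2 ->
  (slide_state F1).1 = (slide_state F2).1 -> slide_code F1 m1 = slide_code F2 m2 ->
  F1 = F2 /\ m1 = m2.
Proof.
move=> s1 i1 h1 s2 i2 h2 eF eM.
have [_ _ _ [b1 c1 r1 f1]] := slide_codeP s1 i1 h1.
have [_ _ _ [b2 c2 r2 f2]] := slide_codeP s2 i2 h2.
rewrite eF eM in b1 c1 r1.
have ea := best_row_uniq b1 b2.
have ep : slide_state F1 = slide_state F2.
  move: eF ea c1; rewrite [slide_state F1]surjective_pairing [slide_state F2]surjective_pairing /=.
  by case: (slide_state F1).2 (slide_state F2).2 c2 => [x y] [x' y'] /= <- -> -> <-.
by split; [rewrite f1 ep -f2|rewrite -r1 ep r2].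
Qed.

Lemma slide_code_surj F M : sorted_from i j F -> diag_inj la F -> hook_list i F M ->
  exists F0 m k, [/\ sorted_from i.+1 j F0, diag_inj la F0, hook_list i.+1 F0 m,
    (slide_state F0).1 = F & slide_code F0 m = M] /\
    exists p, F0 = (iter k bwd (F, p)).1 /\ region la i j p.
Proof.
move=> Fs Fi hM; have [a ba] := best_row_exists F M.
have [rp hi sm ec] := hooks_best hM ba.
set p := (a, hook_col i M a) in rp hi ec.
set m := remove_at (a - i) M in hi sm.
have [hs st] := hole_end rp Fs Fi.
have [dp rp'] := regP rp.
have ra := br_range ba.
pose k := hprime p - (i + j).
have hk : hprime p = i + j + k by rewrite /k; rewrite /p /hprime /= in rp' *; lia.
have [hs' hi' e1 e2] := @backward_run m (F, p) k hs hi hk.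
set s' := iter k bwd (F, p) in hs' hi' e1 e2.
have es : s' = (s'.1, (i, j)) by rewrite -e1; case: (s').
have ss : slide_state s'.1 = (F, p).
  rewrite /slide_state -es; have kn : k <= n by have := hprime_lt hla dp; lia.
  rewrite -(subnK kn) iterD e2.
  by elim: (n - k) => //= t ->; rewrite /fstep /= st.
exists s'.1, m, k; split; last by exists p.
split.
- by apply: sorted_from_step; rewrite -e1.
- exact: hs_inj hs'.
- by apply/hooks_start => //; rewrite -e1.
- by rewrite ss.
- rewrite /slide_code ss /= ec /m; apply: insert_remove_at.
  by rewrite (hl_size hM); lia.
Qed.

End ColumnBijection.

(** * The sorted tableau is uniformly distributed *)

Fixpoint bounded_seqs (B k : nat) : seq (seq nat) :=
  if k is k'.+1 then [seq x :: s | x <- iota 0 B, s <- bounded_seqs B k'] else [:: [::]].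

Lemma mem_bounded_seqs B k s :
  (s \in bounded_seqs B k) = (size s == k) && all (fun x => x < B) s.
Proof.
elim: k s => [|k IH] [|x s] //=; first by apply/allpairsP => - [[y t] []].
rewrite eqSS; apply/allpairsP/idP => [[[y t] /= []]|].
  by rewrite mem_iota /= IH => h1 /andP[h2 h3] [-> ->]; rewrite h2 h3 h1.
move=> /and3P[h1 h2 h3]; exists (x, s); split=> //; last by rewrite IH h1 h3.
by rewrite mem_iota.
Qed.

Lemma uniq_bounded_seqs B k : uniq (bounded_seqs B k).
Proof.
elim: k => //= k IH; apply: allpairs_uniq => //; first exact: iota_uniq.
by move=> [x s] [y t] _ _ [-> ->].
Qed.

Section Stages.
Variables (n : nat) (la : seq nat).
Hypothesis hla : is_partition n la.

Definition reading (F : filling) : seq nat := [seq F c | c <- cells la].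

Definition is_tabloid (F : filling) : Prop :=
  (forall x, ~~ in_diag la x -> F x = 0) /\ reading F \in tabloids n.

Lemma mem_tabloids s : (s \in tabloids n) = perm_eq s (iota 1 n).
Proof. by rewrite mem_permutations. Qed.

Lemma uniq_tabloids : uniq (tabloids n).
Proof. exact: permutations_uniq. Qed.

Lemma size_tabloid s : s \in tabloids n -> size s = n.
Proof. by rewrite mem_tabloids => /perm_size ->; rewrite size_iota. Qed.

Lemma reading_fill s : size s = n -> reading (fill_of la s) = s.
Proof.
move=> sz; apply: (@eq_from_nth _ 0); rewrite size_map (size_cells hla) // => k kn.
have kc : k < size (cells la) by rewrite (size_cells hla).
by rewrite (nth_map (0, 0)) // /fill_of index_uniq // (uniq_cells hla).
Qed.

Lemma fill_reading F : is_tabloid F -> fill_of la (reading F) = F.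
Proof.
move=> [F0 _]; apply: functional_extensionality => x; rewrite /fill_of /reading.
have [xc|xc] := boolP (x \in cells la).
  by rewrite (nth_map (0, 0)) ?index_mem // nth_index.
rewrite nth_default ?F0 -?(mem_cells hla) //.
by rewrite size_map leqNgt index_mem.
Qed.

Lemma is_tabloid_fill s : s \in tabloids n -> is_tabloid (fill_of la s).
Proof.
move=> st; split; last by rewrite reading_fill ?size_tabloid.
move=> x; rewrite -(mem_cells hla) => xc; rewrite /fill_of nth_default //.
by rewrite (size_tabloid st) -(size_cells hla) leqNgt index_mem.
Qed.

Lemma reading_inj F G : is_tabloid F -> is_tabloid G -> reading F = reading G -> F = G.
Proof. by move=> tF tG e; rewrite -(fill_reading tF) -(fill_reading tG) e. Qed.

Lemma tabloid_inj F : is_tabloid F -> diag_inj la F.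
Proof.
move=> [_]; rewrite mem_tabloids => /perm_uniq; rewrite iota_uniq => u x y.
rewrite -!(mem_cells hla) => xc yc e.
rewrite -(nth_index (0, 0) xc) -(nth_index (0, 0) yc); congr nth.
apply/eqP; have := nth_uniq 0 _ _ u (i := index x (cells la)) (j := index y (cells la)).
rewrite size_map !index_mem => <- //.
by rewrite !(nth_map (0, 0)) ?index_mem // !nth_index // e.
Qed.

Lemma tabloid_range F x : is_tabloid F -> in_diag la x -> 0 < F x <= n.
Proof.
move=> [_]; rewrite mem_tabloids => /perm_mem h; rewrite -(mem_cells hla) => xc.
have : F x \in reading F by apply/mapP; exists x.
by rewrite h mem_iota add1n ltnS.
Qed.

Lemma swap_tabloid F p q : in_diag la p -> in_diag la q ->
  is_tabloid F -> is_tabloid (swapf F p q).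
Proof.
move=> dp dq [F0 Ft]; split.
  move=> x dx; rewrite swapf_out ?F0 //; first by apply: contraNneq dx => ->.
  by apply: contraNneq dx => ->.
move: Ft; rewrite !mem_tabloids; apply: perm_trans.
pose sw x := if x == p then q else if x == q then p else x.
have swK : involutive sw.
  move=> x; rewrite /sw; case: (x =P p) => [->|xp].
    by rewrite eqxx; case: eqP.
  by case: (x =P q) => [->|xq]; rewrite ?eqxx //; do 2 case: eqP => //.
have -> : reading (swapf F p q) = map F (map sw (cells la)).
  by rewrite -map_comp; apply: eq_map => x; rewrite /swapf /sw /=; case: (x == p); case: (x == q).
have uc := uniq_cells hla.
apply: perm_map; apply: uniq_perm; [by rewrite map_inj_uniq //; apply: inv_inj|by []|].
have sub x : x \in cells la -> sw x \in cells la.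
  by rewrite !(mem_cells hla) /sw; do 2 case: eqP => // _.
move=> x; apply/mapP/idP => [[y yc ->]|xc]; first exact: sub.
by exists (sw x); rewrite ?swK //; apply: sub.
Qed.

Lemma slide_target_diag F p q : slide_target la F p = Some q -> in_diag la q.
Proof. by case: p => a b; case: slide_targetP => // h _ _ [<-]. Qed.

Lemma slideE f F p : (slide f la F p).1 = (iter f (fstep la) (F, p)).1.
Proof.
elim: f F p => //= f IH F p; rewrite -iterS iterSr {2}/fstep /=.
case e: slide_target => [q|].
  by rewrite -IH; case: slide.
suff -> : iter f (fstep la) (F, p) = (F, p) by [].
by elim: f {IH} => //= f ->; rewrite /fstep /= e.
Qed.

Lemma fstep_tabloid s : is_tabloid s.1 -> in_diag la s.2 ->
  is_tabloid (fstep la s).1 /\ in_diag la (fstep la s).2.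
Proof.
move=> ts ds; rewrite /fstep; case e: slide_target => [q|//].
by have dq := slide_target_diag e; split=> //; apply: swap_tabloid.
Qed.

Lemma slide_tabloid f F p : is_tabloid F -> in_diag la p -> is_tabloid (slide f la F p).1.
Proof.
move=> tF dp; rewrite slideE.
suff [] : is_tabloid (iter f (fstep la) (F, p)).1 /\ in_diag la (iter f (fstep la) (F, p)).2.
  by [].
by elim: f => //= f [h1 h2]; apply: fstep_tabloid.
Qed.

Lemma bstep_tabloid i j k s : is_tabloid s.1 -> in_diag la s.2 ->
  is_tabloid (iter k (bstep i j) s).1.
Proof.
move=> ts ds.
suff [] : is_tabloid (iter k (bstep i j) s).1 /\ in_diag la (iter k (bstep i j) s).2 by [].
elim: k => //= k [h1 h2]; set t := iter _ _ _ in h1 h2 *.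
have d : in_diag la (rtarget i j t.1 t.2).
  apply: (in_diag_le hla) h2; rewrite /rtarget; case: ifP => _ /=;
    try exact: leqnn; exact: leq_pred.
by split=> //; apply: swap_tabloid.
Qed.

Definition run (suf : seq (nat * nat)) (s : seq nat) : filling * nat :=
  foldr (fun c (st : filling * nat) =>
    let: (G, k) := slide n la st.1 c in (G, st.2 + k)) (fill_of la s, 0) suf.

Definition stage suf s : filling := (run suf s).1.

Lemma stage_cons c suf s : stage (c :: suf) s = (slide n la (stage suf s) c).1.
Proof. by rewrite /stage /=; case: slide. Qed.

Lemma run_cons c suf s : (run (c :: suf) s).2 = (run suf s).2 + (slide n la (stage suf s) c).2.
Proof. by rewrite /stage /=; case: slide. Qed.

Lemma stage_tabloid suf s : s \in tabloids n -> {subset suf <= cells la} ->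
  is_tabloid (stage suf s).
Proof.
move=> st; elim: suf => [|c suf IH] sub; first exact: is_tabloid_fill.
rewrite stage_cons; apply: slide_tabloid.
  by apply: IH => x xs; apply: sub; rewrite inE xs orbT.
by rewrite -(mem_cells hla); apply: sub; rewrite inE eqxx.
Qed.

Lemma cells_from_sub i j : {subset cells_from la i j <= cells la}.
Proof. by move=> x; rewrite (mem_cells_from hla) (mem_cells hla) => /andP[]. Qed.

Section Codes.
Variable j : nat.
Notation l := (col_height la j).
Notation E := (col_height la j).-1.

Definition sorted_fromb i (F : filling) : bool :=
  all (fun x => all (fun y =>
    [&& region la i j x, region la i j y, cell_le x y & x != y] ==> (F x < F y))
    (cells la)) (cells la).

Lemma sorted_fromP i F : reflect (sorted_from la i j F) (sorted_fromb i F).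
Proof.
apply: (iffP allP) => [H x y rx ry xy nxy|H x _].
  have xc : x \in cells la by rewrite (mem_cells hla); case/andP: rx.
  have yc : y \in cells la by rewrite (mem_cells hla); case/andP: ry.
  by have /allP/(_ y yc) := H x xc; rewrite rx ry xy nxy.
by apply/allP => y _; apply/implyP => /and4P[? ? ? ?]; apply: H.
Qed.

Definition hook_listb i (F : filling) (M : seq nat) : bool :=
  [&& size M == l - i,
   all (fun h => hook_entry i M h + h + j < nth 0 la h + E) (iota i (l - i)) &
   (0 < i) ==> all (fun h => (E <= hook_entry i M h + h) ==>
      (exitcol j F h (hook_col la j i M h) (h - i).+1 <= j)) (iota i (l - i))].

Lemma hook_listP i F M : reflect (hook_list la j i F M) (hook_listb i F M).
Proof.
apply: (iffP and3P) => [[/eqP s /allP b /implyP r]|[s b r]].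
  split=> // h; first by move=> hh; apply: b; rewrite mem_iota; lia.
  by move=> /r /allP a hh; apply/implyP/a; rewrite mem_iota; lia.
split; first exact/eqP.
  by apply/allP => h; rewrite mem_iota => hh; apply: b; lia.
apply/implyP => i0; apply/allP => h; rewrite mem_iota => hh; apply/implyP.
by apply: r => //; lia.
Qed.

(** The bound [head 0 la + l] only makes the enumeration finite; by [mem_codes] no hook list exceeds
    it. *)
Definition codes i (F : filling) : seq (seq nat) :=
  [seq M <- bounded_seqs (head 0 la + l) (l - i) | sorted_fromb i F && hook_listb i F M].

Lemma mem_codes i F M : (M \in codes i F) = sorted_fromb i F && hook_listb i F M.
Proof.
rewrite mem_filter mem_bounded_seqs.
case sh : (sorted_fromb i F && hook_listb i F M) => //=.
have /andP[_ /hook_listP [s b _]] := sh.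
rewrite s eqxx /=; apply/(all_nthP 0) => k; rewrite s => kl.
have := b (k + i) ltac:(lia); rewrite /hook_entry addnK.
have := row_le hla (leq0n (k + i)); rewrite nth0; lia.
Qed.

Lemma uniq_codes i F : uniq (codes i F).
Proof. by rewrite filter_uniq // uniq_bounded_seqs. Qed.

(** [slide_code] maps the pairs of a tabloid that slides to [F] and one of its hook lists
    bijectively to the hook lists of [F]. *)
Lemma sum_codes i F : i < l -> is_tabloid F ->
  \sum_(s <- tabloids n | reading (slide n la (fill_of la s) (i, j)).1 == reading F)
     size (codes i.+1 (fill_of la s)) = size (codes i F).
Proof.
move=> il tF.
set S := [seq s <- tabloids n | reading (slide n la (fill_of la s) (i, j)).1 == reading F].
have dij : in_diag la (i, j) by rewrite /in_diag /= -(ltn_col_height hla).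
have slS s : (slide n la (fill_of la s) (i, j)).1 = (slide_state n la i j (fill_of la s)).1.
  exact: slideE.
have Sp s : s \in S -> is_tabloid (fill_of la s) /\ (slide_state n la i j (fill_of la s)).1 = F.
  rewrite mem_filter => /andP[/eqP e st]; have ts := is_tabloid_fill st; split=> //.
  by rewrite -slS; apply: reading_inj => //; apply: slide_tabloid.
pose L := [seq (s, m) | s <- S, m <- codes i.+1 (fill_of la s)].
have -> : \sum_(s <- tabloids n | reading (slide n la (fill_of la s) (i, j)).1 == reading F)
     size (codes i.+1 (fill_of la s)) = size L.
  by rewrite size_allpairs_dep sumnE big_map big_filter.
pose f (z : seq nat * seq nat) := slide_code n la i j (fill_of la z.1) z.2.
have Lp z : z \in L -> [/\ z.1 \in S, sorted_from la i.+1 j (fill_of la z.1) &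
    hook_list la j i.+1 (fill_of la z.1) z.2].
  case/allpairsPdep => s [m [sS]]; rewrite mem_codes => /andP[/sorted_fromP h1 /hook_listP h2] ->.
  by split.
rewrite -(size_map f); apply: perm_size; apply: uniq_perm; last first.
- move=> M; apply/mapP/idP => [[[s m] /Lp[/= /Sp[ts es] h1 h2] ->]|].
    have [q1 q2 q3 _] := slide_codeP hla il h1 (tabloid_inj ts) h2.
    rewrite mem_codes; apply/andP; split; first by apply/sorted_fromP; rewrite -es.
    by apply/hook_listP; rewrite -es.
  rewrite mem_codes => /andP[/sorted_fromP h1 /hook_listP h2].
  have [F0 [m [k [[g1 g2 g3 g4 g5] [p [eF0 rp]]]]]] :=
    slide_code_surj hla il h1 (tabloid_inj tF) h2.
  have tF0 : is_tabloid F0 by rewrite eF0; apply: bstep_tabloid => //; case/andP: rp.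
  have eF := fill_reading tF0.
  exists (reading F0, m); last by rewrite /f /= eF.
  apply/allpairsPdep; exists (reading F0), m; split=> //.
    by rewrite mem_filter slS eF g4 eqxx; case: tF0.
  by rewrite mem_codes eF; apply/andP; split; [apply/sorted_fromP|apply/hook_listP].
- exact: uniq_codes.
- rewrite map_inj_in_uniq.
    apply: allpairs_uniq_dep => [||[s m] [s' m'] _ _ /= [-> ->]//].
      by rewrite filter_uniq // uniq_tabloids.
    by move=> s _; apply: uniq_codes.
  move=> [s m] [s' m'] /Lp[/= sS h1 h2] /Lp[/= sS' h1' h2'] e.
  have [ts es] := Sp _ sS; have [ts' es'] := Sp _ sS'.
  have [] := slide_code_inj hla il h1 (tabloid_inj ts) h2 h1' (tabloid_inj ts') h2' _ e.
    by rewrite es es'.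
  move=> eF ->; congr pair.
  have st : s \in tabloids n by move: sS; rewrite mem_filter => /andP[].
  have st' : s' \in tabloids n by move: sS'; rewrite mem_filter => /andP[].
  by rewrite -(reading_fill (size_tabloid st)) -(reading_fill (size_tabloid st')) eF.
Qed.

End Codes.

(** The weighted law carried through a column. [C] collects the numbers of hook lists of the columns
    already finished. *)
Definition uniform_stage (i j : nat) : Prop :=
  exists C, forall F, is_tabloid F ->
    count (fun T => reading (stage (cells_from la i j) T) == reading F) (tabloids n) =
      C * size (codes j i F).

Lemma uniform_end : uniform_stage 0 (head 0 la).
Proof.
have l0 : col_height la (head 0 la) = 0.
  by have := col_height_gt0 hla (head 0 la); rewrite ltnn; case: col_height.
exists 1 => F tF; rewrite (cells_from_end hla) mul1n.
have -> : codes (head 0 la) 0 F = [:: [::]].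
  rewrite /codes l0 /= /hook_listb l0 /= andbT; case: sorted_fromP => // -[].
  move=> x y /regP[/= d rx] _ _ _; have : x.2 < head 0 la.
    by move: d; rewrite /in_diag; have := row_le hla (leq0n x.1); rewrite nth0; lia.
  lia.
rewrite /= (eq_in_count (a2 := pred1 (reading F))).
  by rewrite count_uniq_mem ?uniq_tabloids //; case: tF => _ ->.
by move=> T Tt; rewrite /= /stage /= reading_fill ?size_tabloid.
Qed.

(* For [i = 0] the condition on reverse paths is void, so the number of hook lists
   depends on the shape only. *)
Lemma size_codes0 j F : size (codes j 0 F) = sorted_fromb j 0 F *
  size [seq M <- bounded_seqs (head 0 la + col_height la j) (col_height la j)
    | hook_listb j 0 (fun=> 0) M].
Proof.
rewrite /codes subn0; case: sorted_fromb; last by rewrite filter_pred0.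
by rewrite mul1n; congr size; apply: eq_filter.
Qed.

Lemma reg_col j x : region la (col_height la j) j x = region la 0 j.+1 x.
Proof.
rewrite /region; case d : (in_diag la x) => //=; move: d; rewrite /in_diag -(ltn_col_height hla).
case: (x.2 =P j) => [->|]; lia.
Qed.

Lemma size_codes_col j F : size (codes j (col_height la j) F) = sorted_fromb j.+1 0 F.
Proof.
have -> : sorted_fromb j.+1 0 F = sorted_fromb j (col_height la j) F.
  apply/sorted_fromP/sorted_fromP => H x y rx ry; apply: H.
  - by rewrite -reg_col.
  - by rewrite -reg_col.
  - by rewrite reg_col.
  - by rewrite reg_col.
rewrite /codes /hook_listb subnn /= implybT andbT.
by case: sorted_fromb.
Qed.

Lemma uniform_col j : uniform_stage 0 j.+1 -> uniform_stage (col_height la j) j.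
Proof.
move=> [C H]; exists (C * size [seq M <- bounded_seqs
  (head 0 la + col_height la j.+1) (col_height la j.+1)
  | hook_listb j.+1 0 (fun=> 0) M]) => F tF.
by rewrite (cells_from_col hla) H // size_codes0 size_codes_col; lia.
Qed.

Lemma uniform_step i j : i < col_height la j -> uniform_stage i.+1 j -> uniform_stage i j.
Proof.
move=> il [C H]; exists C => F tF; rewrite cells_from_cons //.
set suf := cells_from la i.+1 j.
have sub : {subset suf <= cells la} by apply: cells_from_sub.
rewrite -sum1_count big_mkcond.
pose Q s := reading (slide n la (fill_of la s) (i, j)).1 == reading F.
(* The tabloids are grouped by their filling [s] just before the slide at [(i, j)], so that the
   induction hypothesis gives the size of each group. *)
transitivity (\sum_(T <- tabloids n) \sum_(s <- tabloids n)
    (reading (stage suf T) == s) * Q s).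
  rewrite big_seq [RHS]big_seq; apply: eq_bigr => T Tt.
  have [t0 tt] := stage_tabloid Tt sub.
  rewrite (bigD1_seq (reading (stage suf T))) ?uniq_tabloids //= eqxx mul1n big1.
    rewrite addn0 stage_cons /Q fill_reading //; by case: eqP.
  by move=> s /negbTE; rewrite eq_sym => ->.
rewrite exchange_big /= -(sum_codes il tF) big_distrr [RHS]big_mkcond /=.
rewrite big_seq [RHS]big_seq; apply: eq_bigr => s st; rewrite -/(Q s).
rewrite -big_distrl /= -(H _ (is_tabloid_fill st)) reading_fill ?size_tabloid //.
rewrite -sum1_count [in RHS]big_mkcond /=.
by case: (Q s); rewrite ?muln0 // muln1; apply: eq_bigr => T _; case: eqP.
Qed.

Lemma uniform_cells : uniform_stage 0 0.
Proof.
apply: (cells_from_ind hla); [exact: uniform_end|by move=> j _; apply: uniform_col|].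
by move=> i j; apply: uniform_step.
Qed.

(** Sortedness is read off the count: the stage of [T] occurs at least once, so it has a hook list,
    whereas [codes] is empty for an unsorted filling. *)
Lemma stage_sorted i j T : uniform_stage i j -> T \in tabloids n ->
  sorted_from la i j (stage (cells_from la i j) T).
Proof.
move=> [C H] Tt.
have tS : is_tabloid (stage (cells_from la i j) T) := stage_tabloid Tt (@cells_from_sub i j).
have := H _ tS; set c := count _ _ => e.
have : 0 < c by rewrite -has_count; apply/hasP; exists T.
rewrite e /codes; case: sorted_fromP => //.
by rewrite filter_pred0 muln0.
Qed.

Lemma standard_sorted F : is_standard la F = sorted_fromb 0 0 F.
Proof.
have regE x : region la 0 0 x = in_diag la x by rewrite /region; case: in_diag => //=; lia.
apply/allP/sorted_fromP => [H|H x]; last first.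
  case: x => a b; rewrite (mem_cells hla) => d; apply/andP; split; apply/implyP => d'.
    apply: H; rewrite ?regE // /cell_le /=; first by lia.
    by apply/eqP => -[]; lia.
  apply: H; rewrite ?regE // /cell_le /=; first by lia.
  by apply/eqP => -[]; lia.
have R a b k : in_diag la (a, b + k) -> F (a, b) <= F (a, b + k).
  elim: k => [|k IH]; first by rewrite addn0.
  rewrite addnS => d; have d' : in_diag la (a, b + k) by apply: (in_diag_le hla) d => /=.
  have := H (a, b + k); rewrite (mem_cells hla) d' d /= => /(_ isT) /andP[h _].
  exact: leq_trans (IH d') (ltnW h).
have D a b k : in_diag la (a + k, b) -> F (a, b) <= F (a + k, b).
  elim: k => [|k IH]; first by rewrite addn0.
  rewrite addnS => d; have d' : in_diag la (a + k, b) by apply: (in_diag_le hla) d => /=.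
  have := H (a + k, b); rewrite (mem_cells hla) d' d /= => /(_ isT) /andP[_ h].
  exact: leq_trans (IH d') (ltnW h).
move=> [a b] [c d]; rewrite !regE /cell_le /= => d1 d2 /andP[ac bd] ne.
have W : forall a' b', a' <= c -> b' <= d -> F (a', b') <= F (c, d).
  move=> a' b' h1 h2; rewrite -(subnKC h1) -(subnKC h2).
  apply: leq_trans (R a' b' (d - b') _) (D a' _ (c - a') _).
    by apply: (in_diag_le hla) d2 => /=; lia.
  by rewrite (subnKC h1) (subnKC h2).
have := H (a, b); rewrite (mem_cells hla) d1 => /(_ isT) /andP[/implyP h1 /implyP h2].
have [lt|ge] := ltnP b d.
  apply: leq_trans (W a b.+1 ac lt); apply: h1; apply: (in_diag_le hla) d2 => //=.
have lt : a < c by move/eqP: ne => ne; apply/contraT => h; case: ne; congr pair; lia.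
apply: leq_trans (W a.+1 b lt bd); apply: h2; apply: (in_diag_le hla) d2 => //=.
Qed.

Lemma sorting_uniform : exists C, forall s, s \in tabloids n ->
  count (fun T => reading (stage (cells la) T) == s) (tabloids n) =
    C * is_standard la (fill_of la s).
Proof.
have [C H] := uniform_cells.
exists (C * size [seq M <- bounded_seqs (head 0 la + col_height la 0) (col_height la 0)
  | hook_listb 0 0 (fun=> 0) M]) => s st.
have := H _ (is_tabloid_fill st); rewrite reading_fill ?size_tabloid // (cells_from00 hla) => ->.
by rewrite size_codes0 standard_sorted; lia.
Qed.

End Stages.

(** * The potential and the exchange of two consecutive entries *)

Definition exch (b v : nat) : nat := if v == b then b.+1 else if v == b.+1 then b else v.

Lemma exchP b v : [\/ v = b /\ exch b v = b.+1, v = b.+1 /\ exch b v = b |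
  [/\ v != b, v != b.+1 & exch b v = v]].
Proof.
rewrite /exch; case: (v =P b) => [->|h]; first by constructor 1.
by case: (v =P b.+1) => [->|h']; [constructor 2|constructor 3].
Qed.

Lemma exchK b : involutive (exch b).
Proof.
move=> v; case: (exchP b v) => [[-> ->]|[-> ->]|[h1 h2 e]].
- by rewrite /exch eqxx; case: eqP => //; lia.
- by rewrite /exch eqxx.
- by rewrite !e.
Qed.

(** Where the value [b] is absent, [b+1] merely drops into the gap. *)
Lemma ltn_exch b v w : v != b -> w != b -> (exch b v < exch b w) = (v < w).
Proof.
by move=> hv hw; case: (exchP b v) => [[]|[]|[]] *; case: (exchP b w) => [[]|[]|[]] *; lia.
Qed.

Lemma exch_small b v : v < b -> exch b v = v.
Proof. by move=> vb; rewrite /exch !ltn_eqF // ltnW. Qed.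

Lemma leq_exch b v w : v < b -> (v <= exch b w) = (v <= w).
Proof. by case: (exchP b w) => [[]|[]|[]] *; lia. Qed.

Lemma ltn_exch_small b v w : v < b -> (v < exch b w) = (v < w).
Proof. by case: (exchP b w) => [[]|[]|[]] *; lia. Qed.

Lemma exch_eqS b v : b <= v -> v != b -> exch b v < b.+1 -> v = b.+1.
Proof. by case: (exchP b v) => [[]|[]|[]] *; lia. Qed.

Section Potential.
Variables (n : nat) (la : seq nat).
Hypothesis hla : is_partition n la.

Definition potential (t : nat) (F : filling) : nat :=
  \sum_(x <- cells la) hprime x * (t <= F x).

(** Written additively, since the difference of potentials may be negative. *)
Lemma potential_swap t F p q : in_diag la p -> in_diag la q -> p != q ->
  potential t (swapf F p q) + hprime p * (t <= F p) + hprime q * (t <= F q) =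
  potential t F + hprime p * (t <= F q) + hprime q * (t <= F p).
Proof.
rewrite -!(mem_cells hla) => dp dq pq; have uc := uniq_cells hla.
have split2 (g : nat * nat -> nat) : \sum_(x <- cells la) g x =
    g p + g q + \sum_(x <- cells la | (x != p) && (x != q)) g x.
  rewrite (bigD1_seq p) //= -addnA; congr addn.
  rewrite [in LHS]big_mkcond (bigD1_seq q) //= eq_sym pq; congr addn.
  rewrite [in LHS]big_mkcond [in RHS]big_mkcond; apply: eq_bigr => x _.
  by case: (x == p); case: (x == q).
rewrite /potential !split2 swapf_l swapf_r.
rewrite (eq_bigr (fun x => hprime x * (t <= F x))); last first.
  by move=> x /andP[h1 h2]; rewrite swapf_out.
lia.
Qed.

(** The entries that are passed are smaller than the slider, hence below [t]. Only the slider can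
    contribute, by one per exchange, and it does so when it equals [t]. *)
Lemma slide_potential f F p t : in_diag la p -> F p <= t ->
  let: (G, k) := slide f la F p in
  potential t G = potential t F + (if t == F p then k else 0).
Proof.
elim: f F p => [|f IH] F p dp pt /=; first by rewrite if_same addn0.
case e : slide_target => [q|]; last by rewrite if_same addn0.
have dq := slide_target_diag e.
have [Fqp hq] : F q < F p /\ hprime q = (hprime p).+1.
  move: e; case: p {dp pt} => a b; case: slide_targetP => // h1 h2 _ [<-].
    by rewrite /hprime /= addnS.
  by rewrite /hprime /= addSn.
have npq : p != q by apply/eqP => pq; move: Fqp; rewrite pq ltnn.
have := potential_swap t F dp dq npq.
have := IH (swapf F p q) q dq; rewrite swapf_r; case: slide => G k /(_ pt) ->.
have -> : (t <= F q) = false by lia.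
by case: (t =P F p) => [->|ne]; rewrite ?leqnn ?hq; lia.
Qed.

Lemma potential_exch b t F : t <= b -> potential t (exch b \o F) = potential t F.
Proof.
move=> tb; apply: eq_bigr => x _; congr (_ * _); congr nat_of_bool => /=.
by case: (exchP b (F x)) => [[]|[]|[]] *; lia.
Qed.

Lemma swapf_comp (g : nat -> nat) F p q : swapf (g \o F) p q = g \o swapf F p q.
Proof.
by apply: functional_extensionality => x; rewrite /swapf /=; case: (x == p); case: (x == q).
Qed.

(** A slide among the cells after [(i, j)] never looks at the entry [b] there, so [ltn_exch]
    preserves all its decisions. *)
Lemma slide_exch_off i j f F b p : region la i.+1 j p -> is_tabloid n la F -> F (i, j) = b ->
  in_diag la (i, j) ->
  slide f la (exch b \o F) p = (exch b \o (slide f la F p).1, (slide f la F p).2) /\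
  (slide f la F p).1 (i, j) = b.
Proof.
move=> + + + dij; elim: f F p => //= f IH F p rp tF Fb.
have Fi := tabloid_inj hla tF.
have nb y : region la i.+1 j y -> F y != b.
  move=> ry; apply/eqP; rewrite -Fb => /Fi e.
  have {}e : y = (i, j) by apply: e => //; case/andP: ry.
  by move: ry; rewrite e /region /=; lia.
have st : slide_target la (exch b \o F) p = slide_target la F p.
  case: p rp => a c rp; have [dp /= rp'] := regP rp.
  have rr : in_diag la (a, c.+1) -> region la i.+1 j (a, c.+1).
    by move=> d; rewrite /region d /=; lia.
  have rb : in_diag la (a.+1, c) -> region la i.+1 j (a.+1, c).
    by move=> d; rewrite /region d /=; lia.
  rewrite /slide_target /=; case: ifP => [/rr /nb h1|_]; case: ifP => [/rb /nb h2|_] //.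
  - by rewrite (ltn_exch h2 h1); case: (F _ < F _); rewrite (ltn_exch _ (nb _ rp)).
  - by rewrite (ltn_exch _ (nb _ rp)).
  - by rewrite (ltn_exch _ (nb _ rp)).
rewrite st; case e : slide_target => [q|//].
have dp : in_diag la p by case/andP: rp.
have dq := slide_target_diag e.
have rq : region la i.+1 j q.
  have [_] := regP rp; rewrite /region dq /=; move: e; case: (p) => a c.
  by case: slide_targetP => // _ _ _ [<-] /=; lia.
have out y : region la i.+1 j y -> (i, j) != y.
  by move=> ry; apply/eqP => e'; move: ry; rewrite -e' /region /=; lia.
have [] := IH (swapf F p q) q rq (swap_tabloid hla dp dq tF).
  by rewrite swapf_out ?out.
by rewrite swapf_comp => ->; case: slide.
Qed.

Lemma reg_up i j x y : region la i j x -> cell_le x y -> in_diag la y -> region la i j y.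
Proof. by move=> /regP[_ rx] /andP[h1 h2] dy; rewrite /region dy; lia. Qed.

(** The sliders [b] and [b+1] meet the same smaller entries until [b] stops. After that [b+1] can
    make at most one further exchange, with [b], and both entries count because [t <= b]. *)
Lemma slide_exch_potential i j f F p b t : hole_sorted la i j F p -> is_tabloid n la F ->
  F p = b -> t <= b ->
  potential t (slide f la (exch b \o F) p).1 = potential t (slide f la F p).1.
Proof.
move=> + + + tb; elim: f F p => [|f IH] F p hs tF Fb; first exact: potential_exch.
have [rp Fi Fs Fl] := hs; have [dp _] := regP rp.
have b0 : 0 < b by have /andP[] := tabloid_range hla tF dp; rewrite Fb.
have step q : slide_target la F p = Some q -> slide_target la (exch b \o F) p = Some q ->
    potential t (slide f.+1 la (exch b \o F) p).1 = potential t (slide f.+1 la F p).1.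
  move=> e1 e2; rewrite /= e1 e2 swapf_comp.
  have := IH _ _ (hole_target hla hs e1) (swap_tabloid hla dp (slide_target_diag e1) tF).
  by rewrite swapf_r => /(_ Fb); do 2 case: slide.
case: p Fb hs rp Fs Fl dp step => a c Fb hs rp Fs Fl dp step.
have ne y : in_diag la y -> y != (a, c) -> F y != b.
  by move=> dy; apply: contra_neq; rewrite -Fb; apply: Fi.
have nr : (a, c.+1) != (a, c) by rewrite xpair_eqE [c.+1 == c]eqn_leq ltnn andbF.
have nd : (a.+1, c) != (a, c) by rewrite xpair_eqE [a.+1 == a]eqn_leq ltnn.
have eb : exch b b = b.+1 by rewrite /exch eqxx.
have eb' : exch b b.+1 = b by rewrite -eb exchK.
case e : (slide_target la F (a, c)) => [q|].
  apply: (step q e); move: e; case: slide_targetP => // h1 h2 h3 [<-]; rewrite Fb in h2.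
    apply: slide_target_right => //= [|d]; first by rewrite Fb eb exch_small // ltnW.
    by rewrite exch_small // leq_exch //; apply: h3.
  apply: slide_target_down => //= [|d]; first by rewrite Fb eb exch_small // ltnW.
  by rewrite exch_small // ltn_exch_small //; apply: h3.
rewrite /= e; case e' : slide_target => [q|] /=; last exact: potential_exch.
have dq := slide_target_diag e'.
have [Fq pq nq] : [/\ F q = b.+1, cell_le (a, c) q & q != (a, c)].
  move: e e'; case: slide_targetP => // h1 h2 _; case: slide_targetP => // d /= + _ [<-];
    rewrite Fb eb; split; rewrite // /cell_le /= ?leqnn ?leqnSn //.
    by apply: exch_eqS => //; [rewrite -Fb h1|apply: ne].
  by apply: exch_eqS => //; [rewrite -Fb h2|apply: ne].
have rq := reg_up rp pq dq.
(* The slider [b.+1] was exchanged with [b], which restores the original filling. *)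
have -> : swapf (exch b \o F) (a, c) q = F.
  apply: functional_extensionality => x; rewrite /swapf /= Fq Fb eb.
  case: (x =P (a, c)) => [->|/eqP xp]; first by rewrite eb'.
  case: (x =P q) => [->//|/eqP xq].
  have [dx|dx] := boolP (in_diag la x).
    have h1 := ne _ dx xp; have h2 : F x != b.+1.
      by move: xq; apply: contra_neq; rewrite -Fq; apply: Fi.
    by rewrite /exch (negbTE h1) (negbTE h2).
  by case: tF => /(_ x dx) -> _; rewrite exch_small.
suff -> : slide f la F q = (F, 0) by [].
case: f {IH step} => //= f; suff -> : slide_target la F q = None by [].
have up y : in_diag la y -> cell_le q y -> y != q -> F q < F y.
  move=> dy qy yq; apply: Fs => //; [exact: reg_up qy dy| |by rewrite eq_sym].
  by apply: contra_neq nq => yp; apply: cell_le_anti => //; rewrite -yp.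
clear Fq rq nq pq e' dq; case: q up => x y up.
case: slide_targetP => // d + _; rewrite ltnNge ltnW // up //.
- by rewrite /cell_le /= leqnn leqnSn.
- by rewrite xpair_eqE [y.+1 == y]eqn_leq ltnn andbF.
- by rewrite /cell_le /= leqnn leqnSn.
- by rewrite xpair_eqE [x.+1 == x]eqn_leq ltnn.
Qed.

End Potential.

(** * Summation over tabloids *)

Section Summation.
Variables (n : nat) (la : seq nat).
Hypothesis hla : is_partition n la.

Lemma map_exch_tabloid b s : 0 < b < n -> s \in tabloids n -> map (exch b) s \in tabloids n.
Proof.
move=> bn; rewrite !mem_tabloids => /(perm_map (exch b)) h; apply: perm_trans h _.
have ei := inv_inj (exchK b).
apply: uniq_perm; rewrite ?map_inj_uniq ?iota_uniq // => x.
have sub y : y \in iota 1 n -> exch b y \in iota 1 n.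
  by rewrite !mem_iota; case: (exchP b y) => [[]|[]|[]] *; lia.
apply/mapP/idP => [[y yi ->]|xi]; first exact: sub.
by exists (exch b x); rewrite ?exchK //; apply: sub.
Qed.

Lemma perm_map_exch b : 0 < b < n -> perm_eq (map (map (exch b)) (tabloids n)) (tabloids n).
Proof.
move=> bn; have mk : involutive (map (exch b)) by apply: mapK; apply: exchK.
apply: uniq_perm; rewrite ?map_inj_uniq ?uniq_tabloids //; first exact: inv_inj.
move=> s; apply/mapP/idP => [[t tt ->]|st]; first exact: map_exch_tabloid.
by exists (map (exch b) s); rewrite ?mk //; apply: map_exch_tabloid.
Qed.

Lemma fill_exch b s : 0 < b -> fill_of la (map (exch b) s) = exch b \o fill_of la s.
Proof.
move=> b0; apply: functional_extensionality => x; rewrite /fill_of /=.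
have [xs|xs] := ltnP (index x (cells la)) (size s); first by rewrite (nth_map 0).
(* Past the end of [s] the default value 0 is read, and [exch b] fixes it because [0 < b]. *)
rewrite !nth_default ?size_map //; case: (exchP b 0) => [[]|[]|[]] *; lia.
Qed.

Lemma stage_exch i j b s : 0 < b < n -> in_diag la (i, j) -> s \in tabloids n ->
  fill_of la s (i, j) = b ->
  stage n la (cells_from la i.+1 j) (map (exch b) s) =
    exch b \o stage n la (cells_from la i.+1 j) s /\
  stage n la (cells_from la i.+1 j) s (i, j) = b.
Proof.
move=> bn dij st sb.
have : {subset cells_from la i.+1 j <= cells_from la i.+1 j} by [].
elim: {1 3 4 5}(cells_from la i.+1 j) => [|c suf IH] sub.
  by rewrite /stage /= fill_exch //; case/andP: bn.
have [|e1 e2] := IH; first by move=> x xs; apply: sub; rewrite inE xs orbT.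
rewrite !stage_cons e1.
have rc : region la i.+1 j c by rewrite -(mem_cells_from hla); apply: sub; rewrite inE eqxx.
have tS : is_tabloid n la (stage n la suf s).
  apply: (stage_tabloid hla st) => x xs; apply: (@cells_from_sub n la hla i.+1 j).
  by apply: sub; rewrite inE xs orbT.
by have [-> ->] := @slide_exch_off n la hla i j n _ b c rc tS e2 dij.
Qed.

Local Open Scope ring_scope.

(** * The growth of the potential during a single slide *)

Definition gain (t : nat) (F : filling) (c : nat * nat) : rat :=
  (potential la t (slide n la F c).1)%:R - (potential la t F)%:R.

Section Step.
Variables (i j : nat).
Hypothesis il : (i < col_height la j)%N.
Hypothesis us : uniform_stage n la i.+1 j.
Notation c := (i, j).
Notation A := (stage n la (cells_from la i.+1 j)).

Lemma dij : in_diag la c.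
Proof. by rewrite /in_diag /= -(ltn_col_height hla). Qed.

Definition gain_at (t b : nat) : rat :=
  \sum_(s <- tabloids n | fill_of la s c == b) gain t (A s) c.

Lemma tabA s : s \in tabloids n -> is_tabloid n la (A s).
Proof. by move=> st; apply: (stage_tabloid hla st); apply: (@cells_from_sub n la hla). Qed.

Lemma stage_untouched s : s \in tabloids n -> A s c = fill_of la s c.
Proof.
move=> st; have : {subset cells_from la i.+1 j <= cells_from la i.+1 j} by [].
elim: {1 3}(cells_from la i.+1 j) => [//|d suf IH] sub.
rewrite stage_cons -IH; last by move=> x xs; apply: sub; rewrite inE xs orbT.
have : region la i.+1 j d by rewrite -(mem_cells_from hla); apply: sub; rewrite inE eqxx.
elim: n (stage n la suf s) d {sub} => //= f IHf F d rd.
case e : slide_target => [q|//].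
have dq := slide_target_diag e.
have rq : region la i.+1 j q.
  have [_] := regP rd; rewrite /region dq /=; move: e; case: (d) => a b.
  by case: slide_targetP => // _ _ _ [<-] /=; lia.
have out y : region la i.+1 j y -> c != y.
  by move=> ry; apply/eqP => e'; move: ry; rewrite -e' /region /=; lia.
by have := IHf (swapf F d q) q rq; case: slide => G k /= ->; rewrite swapf_out ?out.
Qed.

(* Before the slide at [c], the entry [b] at [c] does not take part, so exchanging
   [b] and [b.+1] commutes with all previous slides. *)
Lemma gain_at_exch t b : (0 < b < n)%N -> (t <= b)%N -> gain_at t b = gain_at t b.+1.
Proof.
move=> bn tb; rewrite /gain_at -[in RHS](perm_big _ (perm_map_exch bn)) /= big_map.
rewrite big_seq_cond [RHS]big_seq_cond.
have b0 : (0 < b)%N by case/andP: bn.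
apply: eq_big => [s|s /andP[st /eqP sb]].
  rewrite fill_exch //=; case: (s \in _) => //=.
  by case: (exchP b (fill_of la s c)) => [[]|[]|[]] *; lia.
have [-> eb] := stage_exch bn dij st sb.
rewrite /gain (potential_exch hla) // (@slide_exch_potential n la hla i j n _ c b t) //.
- apply: (hole_start hla il); last exact: (tabloid_inj hla (tabA st)).
  exact: (stage_sorted hla us st).
- exact: tabA.
Qed.

Lemma sum_by_entry (f : seq nat -> rat) :
  \sum_(s <- tabloids n) f s =
  \sum_(1 <= b < n.+1) \sum_(s <- tabloids n | fill_of la s c == b) f s.
Proof.
under [RHS]eq_bigr do rewrite big_mkcond.
rewrite exchange_big /= big_seq [RHS]big_seq; apply: eq_bigr => s st.
have h := tabloid_range hla (is_tabloid_fill hla st) dij.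
rewrite (bigD1_seq (fill_of la s c)) ?iota_uniq ?mem_index_iota //= eqxx.
by rewrite big1 ?addr0 // => b /negbTE; rewrite eq_sym => ->.
Qed.

Lemma gain_at_low t b : (b < t)%N -> gain_at t b = 0.
Proof.
move=> bt; rewrite /gain_at big_seq_cond big1 // => s /andP[st /eqP sb].
have := @slide_potential n la hla n (A s) c t dij; rewrite stage_untouched // sb.
rewrite /gain; case: slide => G k /(_ (ltnW bt)) ->.
by rewrite gtn_eqF // addn0 subrr.
Qed.

Lemma gain_at_diag b :
  gain_at b b = \sum_(s <- tabloids n | fill_of la s c == b) (slide n la (A s) c).2%:R.
Proof.
rewrite /gain_at big_seq_cond [RHS]big_seq_cond; apply: eq_bigr => s /andP[st /eqP sb].
have := @slide_potential n la hla n (A s) c b dij; rewrite stage_untouched // sb.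
rewrite /gain; case: slide => G k /(_ (leqnn b)) ->.
by rewrite eqxx natrD addrC addKr.
Qed.

Lemma gain_at_const t b : (0 < t)%N -> (t <= b <= n)%N -> gain_at t b = gain_at t t.
Proof.
move=> t0; elim: b => [|b IH] h; first by lia.
have [tb|tb] := leqP t b; last by have -> : t = b.+1 by lia.
by rewrite -IH; [symmetry; apply: gain_at_exch => //|]; lia.
Qed.

Lemma sum_slide_steps :
  \sum_(s <- tabloids n) (slide n la (A s) c).2%:R =
  \sum_(1 <= t < n.+1) (n - t).+1%:R^-1 * \sum_(s <- tabloids n) gain t (A s) c :> rat.
Proof.
rewrite sum_by_entry big_nat [RHS]big_nat; apply: eq_bigr => t /andP[t0 tn].
rewrite -gain_at_diag sum_by_entry -/(gain_at t) (big_cat_nat _ (n := t)) //=; last exact: ltnW.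
rewrite big_nat big1 ?add0r; last by move=> b /andP[_]; apply: gain_at_low.
rewrite (eq_big_nat _ _ (F2 := fun=> gain_at t t)); last by move=> b h; apply: gain_at_const; lia.
rewrite sumr_const_nat subSn; last by lia.
by rewrite -[gain_at t t *+ _]mulr_natl mulKf // pnatr_eq0.
Qed.

End Step.

(** * Telescoping over all slides *)

Definition total_gain (i j : nat) (t : nat) : rat :=
  \sum_(s <- tabloids n) ((potential la t (stage n la (cells_from la i j) s))%:R
     - (potential la t (fill_of la s))%:R).

Lemma sum_run : \sum_(s <- tabloids n) (run n la (cells la) s).2%:R =
  \sum_(1 <= t < n.+1) (n - t).+1%:R^-1 * total_gain 0 0 t :> rat.
Proof.
rewrite (cells_from00 hla).
(* [uniform_stage] is carried along because [sum_slide_steps] relies on the cells after [(i, j)]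
   being sorted, which [stage_sorted] derives from it. *)
suff [] : uniform_stage n la 0 0 /\ \sum_(s <- tabloids n) (run n la (cells_from la 0 0) s).2%:R =
  \sum_(1 <= t < n.+1) (n - t).+1%:R^-1 * total_gain 0 0 t :> rat by [].
apply: (@cells_from_ind n la hla (fun i j => uniform_stage n la i j /\
  \sum_(s <- tabloids n) (run n la (cells_from la i j) s).2%:R =
  \sum_(1 <= t < n.+1) (n - t).+1%:R^-1 * total_gain i j t :> rat)).
- split; first exact: uniform_end.
  rewrite /total_gain (cells_from_end hla) big1 // big1 // => t _.
  by rewrite big1 ?mulr0 // => s _; rewrite /stage /= subrr.
- move=> j _ [us e]; split; first exact: uniform_col.
  by rewrite /total_gain (cells_from_col hla) e.
- move=> i j il [us e]; split; first exact: uniform_step.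
  rewrite (cells_from_cons il); under eq_bigr do rewrite run_cons natrD.
  rewrite big_split /= e sum_slide_steps // -big_split /=; apply: eq_bigr => t _.
  rewrite -mulrDr /total_gain -big_split /= (cells_from_cons il); congr (_ * _).
  by apply: eq_bigr => s _; rewrite stage_cons /gain; ring.
Qed.

(** [nps_exchanges] starts at the last cell but one, while [run] visits every cell. The two agree
    since the last cell has neither a right nor a lower neighbour. *)
Lemma slide_last : cells la = [::] \/
  exists z' zn, cells la = rcons z' zn /\ forall F, slide_target la F zn = None.
Proof.
rewrite (cells_from00 hla); apply: (@cells_from_ind n la hla (fun i j => cells_from la i j = [::] \/
  exists z' zn, cells_from la i j = rcons z' zn /\ forall F, slide_target la F zn = None)).
- by left; rewrite (cells_from_end hla).
- by move=> j _; rewrite (cells_from_col hla).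
- move=> i j il; rewrite (cells_from_cons il) => -[e|[z' [zn [-> h]]]]; right; last first.
    by exists ((i, j) :: z'), zn.
  exists [::], (i, j); rewrite e; split=> // F; rewrite /slide_target /=.
  have m := mem_cells_from hla i.+1 j; rewrite e in m.
  have -> : in_diag la (i, j.+1) = false.
    by have := m (i, j.+1); rewrite in_nil /region /= ltnSn andbT.
  have -> // : in_diag la (i.+1, j) = false.
  by have := m (i.+1, j); rewrite in_nil /region /= eqxx leqnn orbT andbT.
Qed.

Lemma nps_run s : nps_exchanges la (fill_of la s) = (run n la (cells la) s).2.
Proof.
rewrite /nps_exchanges (size_cells hla) foldl_rev /run.
have sz := size_cells hla.
case: slide_last => [e|[z' [zn [e h]]]]; first by rewrite e.
have -> : take n.-1 (cells la) = z'.
  by rewrite -sz e size_rcons -cats1 take_size_cat.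
rewrite e foldr_rcons.
have -> : slide n la (fill_of la s) zn = (fill_of la s, 0%N); last by [].
by case: (n) => //= k; rewrite h.
Qed.

Lemma count_tabloids : size (tabloids n) = n`!.
Proof. by rewrite size_permutations ?iota_uniq // size_iota. Qed.

(** By the symmetry [perm_map_exch], all [n] values are equally frequent at [x]. *)
Lemma sum_entry_ge x t : (0 < t <= n)%N -> in_diag la x ->
  n%:R * \sum_(s <- tabloids n) (t <= fill_of la s x)%:R = (n - t).+1%:R * n`!%:R :> rat.
Proof.
move=> tn dx.
pose m b : rat := \sum_(s <- tabloids n) (fill_of la s x == b)%:R.
have mS b : (0 < b < n)%N -> m b = m b.+1.
  move=> bn; rewrite /m -[RHS](perm_big _ (perm_map_exch bn)) big_map; apply: eq_bigr => s _.
  rewrite fill_exch /=; last by lia.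
  by congr (nat_of_bool _)%:R; case: (exchP b (fill_of la s x)) => [[]|[]|[]] *; lia.
have mc b : (0 < b <= n)%N -> m b = m 1%N.
  elim: b => // b IH h; have [->//|b0] := posnP b.
  by rewrite -mS ?IH //; lia.
have ge u : (0 < u <= n)%N ->
    \sum_(s <- tabloids n) (u <= fill_of la s x)%:R = (n - u).+1%:R * m 1%N :> rat.
  move=> un; transitivity (\sum_(u <= b < n.+1) m b).
    rewrite exchange_big /= big_seq [RHS]big_seq; apply: eq_bigr => s st.
    have h := tabloid_range hla (is_tabloid_fill hla st) dx.
    case: leqP => hu; last first.
      by rewrite big_nat big1 // => b hb; have -> : (fill_of la s x == b) = false by lia.
    have hm : fill_of la s x \in index_iota u n.+1 by rewrite mem_index_iota; lia.
    rewrite (bigD1_seq _ hm) ?iota_uniq //= eqxx.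
    by rewrite big1 ?addr0 // => b /negbTE; rewrite eq_sym => ->.
  rewrite (eq_big_nat _ _ (F2 := fun=> m 1%N)); last by move=> b h; apply: mc; lia.
  by rewrite sumr_const_nat subSn ?mulr_natl //; lia.
have n1 : n%:R * m 1%N = n`!%:R.
  have := ge 1%N ltac:(lia); rewrite subn1 prednK; last by lia.
  move=> <-; rewrite -count_tabloids big_seq (eq_bigr (fun=> 1)); last first.
    by move=> s st; have /andP[-> _] := tabloid_range hla (is_tabloid_fill hla st) dx.
  by rewrite -big_seq big_const_seq count_predT iter_addr_0.
by rewrite ge // -n1; ring.
Qed.

Definition diag_weight : rat := \sum_(x <- cells la) (hprime x)%:R.

Lemma sum_initial_potential t : (0 < t <= n)%N ->
  (n - t).+1%:R^-1 * \sum_(s <- tabloids n) (potential la t (fill_of la s))%:R =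
  n`!%:R / n%:R * diag_weight.
Proof.
move=> tn; rewrite /potential.
under eq_bigr do rewrite natr_sum.
rewrite exchange_big /= /diag_weight !mulr_sumr big_seq [RHS]big_seq.
apply: eq_bigr => x; rewrite (mem_cells hla) => dx.
under eq_bigr do rewrite natrM.
rewrite -mulr_sumr.
have := sum_entry_ge tn dx; set S := \sum_(_ <- _) _ => e.
have n0 : n%:R != 0 :> rat by rewrite pnatr_eq0; lia.
have t0 : (n - t).+1%:R != 0 :> rat by rewrite pnatr_eq0.
have -> : S = (n - t).+1%:R * n`!%:R / n%:R by rewrite -e mulrC mulKf.
by field; rewrite n0 nat1r t0.
Qed.

Lemma sum_final (C : nat) (g : filling -> rat) :
  (forall s, s \in tabloids n ->
    count (fun T => reading la (stage n la (cells la) T) == s) (tabloids n) =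
    (C * is_standard la (fill_of la s))%N) ->
  \sum_(T <- tabloids n) g (stage n la (cells la) T) =
  C%:R * \sum_(s <- tabloids n | is_standard la (fill_of la s)) g (fill_of la s).
Proof.
move=> H.
transitivity (\sum_(T <- tabloids n) \sum_(s <- tabloids n)
    (reading la (stage n la (cells la) T) == s)%:R * g (fill_of la s)).
  rewrite big_seq [RHS]big_seq; apply: eq_bigr => T Tt.
  have tS := stage_tabloid hla Tt (fun x h => h); have [_ tt] := tS.
  rewrite (bigD1_seq (reading la (stage n la (cells la) T))) ?uniq_tabloids //= eqxx mul1r.
  rewrite big1 ?addr0 ?(fill_reading hla) // => s /negbTE; rewrite eq_sym => ->.
  by rewrite mul0r.
rewrite exchange_big /= mulr_sumr [RHS]big_mkcond big_seq [RHS]big_seq.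
apply: eq_bigr => s st; rewrite -mulr_suml -natr_sum.
have -> : (\sum_(T <- tabloids n) (reading la (stage n la (cells la) T) == s) =
    C * is_standard la (fill_of la s))%N.
  by rewrite -H // -sum1_count [RHS]big_mkcond; apply: eq_bigr => T _; case: eqP.
by case: is_standard; rewrite ?muln1 // muln0 mul0r.
Qed.

End Summation.

(** * Harmonic numbers and the final formula *)

Local Open Scope ring_scope.

Lemma harmonicS m : harmonic m.+1 = harmonic m + (m.+1%:R)^-1.
Proof. by rewrite /harmonic big_nat_recr. Qed.

Lemma harmonic_diff n k : (k <= n)%N ->
  \sum_(1 <= t < n.+1) (t <= k)%:R * (n - t).+1%:R^-1 = harmonic n - harmonic (n - k).
Proof.
elim: k => [|k IH] kn.
  rewrite subn0 subrr big_nat big1 // => t /andP[t0 _].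
  by rewrite leqNgt t0 mul0r.
have hk : k.+1 \in index_iota 1 n.+1 by rewrite mem_index_iota; lia.
rewrite (eq_bigr (fun t => (t <= k)%:R * (n - t).+1%:R^-1 + (t == k.+1)%:R * (n - t).+1%:R^-1)).
  rewrite big_split /= (IH (ltnW kn)) (bigD1_seq k.+1 hk) ?iota_uniq //= eqxx big1 ?addr0.
    by rewrite mul1r (_ : n - k = (n - k.+1).+1)%N ?harmonicS; [ring|lia].
  by move=> t /negbTE ->; rewrite mul0r.
move=> t _; rewrite -mulrDl -natrD; congr (_%:R * _).
by case: (ltngtP t k.+1) => h; case: leqP => h'; lia.
Qed.

Section Complexity.
Variables (n : nat) (la : seq nat).
Hypothesis hla : is_partition n la.

Lemma sum_fsyt_at x (g : nat -> rat) : in_diag la x ->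
  \sum_(s <- tabloids n | is_standard la (fill_of la s)) g (fill_of la s x) =
  \sum_(1 <= k < n.+1) (fsyt_at n la k x)%:R * g k.
Proof.
move=> dx.
transitivity (\sum_(1 <= k < n.+1) \sum_(s <- tabloids n | is_standard la (fill_of la s))
   (fill_of la s x == k)%:R * g k).
  rewrite exchange_big /= big_seq_cond [RHS]big_seq_cond; apply: eq_bigr => s /andP[st _].
  have h := tabloid_range hla (is_tabloid_fill hla st) dx.
  have hm : fill_of la s x \in index_iota 1 n.+1 by rewrite mem_index_iota; lia.
  rewrite (bigD1_seq _ hm) ?iota_uniq //= eqxx mul1r big1 ?addr0 //.
  by move=> b /negbTE; rewrite eq_sym => ->; rewrite mul0r.
apply: eq_bigr => k _; rewrite -mulr_suml -natr_sum; congr (_%:R * _).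
rewrite /fsyt_at -sum1_count [LHS]big_mkcond [RHS]big_mkcond; apply: eq_bigr => s _.
by case: is_standard => //=; case: eqP.
Qed.

Lemma complexityE : complexity n la =
  \sum_(x <- cells la) \sum_(1 <= k < n.+1)
    (hprime x)%:R * ((fsyt_at n la k x)%:R / (fsyt n la)%:R) * (harmonic n - harmonic (n - k))
  - diag_weight la /\ (fsyt n la)%:R != 0 :> rat.
Proof.
have [C HC] := sorting_uniform hla.
have nf0 : n`!%:R != 0 :> rat by rewrite pnatr_eq0 -lt0n fact_gt0.
(* The constant function 1 in [sum_final] counts all tabloids. This identifies [C] as the quotient
   of [n!] by the number of standard tableaux, and shows that there are any. *)
have Cf : C%:R * (fsyt n la)%:R = n`!%:R :> rat.
  have := sum_final hla (fun=> 1%:R) HC.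
  rewrite -!natr_sum -count_tabloids !sum1_size => ->.
  by rewrite /fsyt sum1_count.
have f0 : (fsyt n la)%:R != 0 :> rat.
  by apply/eqP => e; move: nf0; rewrite -Cf e mulr0 eqxx.
have C0 : C%:R != 0 :> rat.
  by apply/eqP => e; move: nf0; rewrite -Cf e mul0r eqxx.
split=> //; rewrite /complexity.
under eq_bigr do rewrite (nps_run hla).
rewrite (sum_run hla).
have tg t : (0 < t <= n)%N -> (n - t).+1%:R^-1 * total_gain n la 0 0 t =
    C%:R * \sum_(x <- cells la) \sum_(1 <= k < n.+1)
      (hprime x)%:R * (fsyt_at n la k x)%:R * ((t <= k)%:R * (n - t).+1%:R^-1)
    - n`!%:R / n%:R * diag_weight la.
  move=> tn; rewrite /total_gain sumrB mulrBr (sum_initial_potential hla tn) -(cells_from00 hla).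
  congr (_ - _); rewrite (sum_final hla (fun F => (potential la t F)%:R) HC) mulrCA.
  congr (_ * _); under eq_bigr do rewrite natr_sum.
  rewrite exchange_big mulr_sumr big_seq [RHS]big_seq; apply: eq_bigr => x /=.
  rewrite (mem_cells hla) => dx; under eq_bigr do rewrite natrM.
  rewrite -mulr_sumr (sum_fsyt_at (fun v => (t <= v)%:R) dx) !mulr_sumr.
  by apply: eq_bigr => k _; ring.
rewrite (eq_big_nat _ _ (F2 := fun t => C%:R * \sum_(x <- cells la) \sum_(1 <= k < n.+1)
      (hprime x)%:R * (fsyt_at n la k x)%:R * ((t <= k)%:R * (n - t).+1%:R^-1)
    - n`!%:R / n%:R * diag_weight la)); last by move=> t ht; apply: tg; lia.
rewrite sumrB -mulr_sumr mulrBl; congr (_ - _).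
  rewrite exchange_big /= mulr_sumr mulr_suml; apply: eq_bigr => x _.
  rewrite exchange_big /= mulr_sumr mulr_suml; apply: eq_big_nat => k hk.
  by rewrite -mulr_sumr harmonic_diff -?Cf; [field; rewrite f0 C0|lia].
rewrite sumr_const_nat subn1 /=.
(* For [n = 0] the factor [n! / n] divides by zero, but then the diagram is empty and its weight
   vanishes. *)
have [n0|n0] := posnP n.
  have c0 : cells la = [::] by apply: size0nil; rewrite (size_cells hla).
  by rewrite /diag_weight c0 big_nil n0 mulr0n mul0r.
have nn : n%:R != 0 :> rat by rewrite pnatr_eq0 -lt0n.
by rewrite -mulr_natl; field; rewrite nn nf0.
Qed.

Lemma diag_weightE : diag_weight la =
  (\sum_(a <- la) 'C(a, 2))%:R + (\sum_(a <- conj_part la) 'C(a, 2))%:R.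
Proof. by rewrite /diag_weight -natr_sum (sum_hprime hla) natrD. Qed.

(** For each cell [x] the probabilities of its possible entries add up to one. This lets the term
    [- diag_weight la] be merged into the sum over [k]. *)
Lemma sum_weight_prob : \sum_(x <- cells la) \sum_(1 <= k < n.+1)
    (hprime x)%:R * ((fsyt_at n la k x)%:R / (fsyt n la)%:R) = diag_weight la.
Proof.
have [_ f0] := complexityE.
rewrite /diag_weight big_seq [RHS]big_seq; apply: eq_bigr => x; rewrite (mem_cells hla) => dx.
rewrite -mulr_sumr -mulr_suml.
have := sum_fsyt_at (fun=> 1%:R) dx.
rewrite -natr_sum sum1_count -/(fsyt n la) => e.
under eq_bigr do rewrite -[(fsyt_at _ _ _ _)%:R]mulr1.
by rewrite -e divff // mulr1.
Qed.

End Complexity.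

Theorem theorem5 (n : nat) (la : seq nat) (hla : is_partition n la) :
  complexity n la =
    ((\sum_(a <- la) 'C(a, 2))%:R + (\sum_(a <- conj_part la) 'C(a, 2))%:R)
      * (harmonic n - 1)
    - \sum_(x <- cells la) \sum_(1 <= k < n)
        (hprime x)%:R * ((fsyt_at n la k x)%:R / (fsyt n la)%:R)
        * harmonic (n - k)
  /\
  ((\sum_(a <- la) 'C(a, 2))%:R + (\sum_(a <- conj_part la) 'C(a, 2))%:R)
      * (harmonic n - 1)
    - \sum_(x <- cells la) \sum_(1 <= k < n)
        (hprime x)%:R * ((fsyt_at n la k x)%:R / (fsyt n la)%:R)
        * harmonic (n - k)
  = \sum_(x <- cells la) \sum_(1 <= k < n.+1)
        (hprime x)%:R * ((fsyt_at n la k x)%:R / (fsyt n la)%:R)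
        * (harmonic n - harmonic (n - k) - 1).
Proof.
have [cE _] := complexityE hla; have pE := sum_weight_prob hla.
rewrite -(diag_weightE hla).
set S := \sum_(x <- cells la) \sum_(1 <= k < n) _.
(* Including [k = n] adds nothing here because [harmonic 0 = 0]. In the second form the term for
   [k = n] carries the factor [H_n - 1], which in general is not zero, so there the range does reach
   [n]. *)
have SE : S = \sum_(x <- cells la) \sum_(1 <= k < n.+1)
    (hprime x)%:R * ((fsyt_at n la k x)%:R / (fsyt n la)%:R) * harmonic (n - k).
  apply: eq_bigr => x _; case: (n) => [|m]; first by rewrite !big_geq.
  have h0 : harmonic 0 = 0 by rewrite /harmonic big_geq.
  by rewrite [RHS]big_nat_recr //= subnn h0 mulr0 addr0.
have e2 : diag_weight la * (harmonic n - 1) - S =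
    \sum_(x <- cells la) \sum_(1 <= k < n.+1)
        (hprime x)%:R * ((fsyt_at n la k x)%:R / (fsyt n la)%:R)
        * (harmonic n - harmonic (n - k) - 1).
  rewrite SE -pE mulr_suml -sumrB; apply: eq_bigr => x _.
  by rewrite mulr_suml -sumrB; apply: eq_bigr => k _; ring.
split=> //; rewrite e2 cE -pE -sumrB; apply: eq_bigr => x _.
by rewrite -sumrB; apply: eq_bigr => k _; ring.
Qed.
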